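(* There exists a free product $G$ of two infinite cyclic groups with commuting subgroups such that the submonoid membership problem in $G$ is undecidable.
   Context: If $A, B$ are groups with subgroups $H\le A$ and $K\le B$, the free product of $A$ and $B$ with commuting subgroups $H$ and $K$ is the quotient of the free product $A * B$ by the normal closure of all commutators $[h,k]=hkh^{-1}k^{-1}$ with $h\in H$, $k\in K$. The submonoid membership problem in a fixed group $G$ with finite generating set $S$ takes as input words $u,w_1,\dots,w_r$ over $S\cup S^{-1}$ (with $r$ arbitrary), and asks whether the element of $G$ represented by $u$ lies in the submonoid of $G$ generated by the elements represented by $w_1,\dots,w_r$. *)

(* Defs.v *)
From HB Require Import structures.
From mathcomp Require Import all_boot.
From mathcomp Require Import boolp classical_sets functions cardinality.

Set Implicit Arguments.
Unset Strict Implicit.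
Unset Printing Implicit Defensive.

Local Open Scope classical_set_scope.
Local Open Scope group_scope.
Local Open Scope quotient_scope.

(* Groups are the possibly infinite groupType of boot/monoid.v; subsets are   *)
(* classical sets, and "generated by" is the intersection [smallest].         *)

Section Subsets.
Variable G : groupType.
Implicit Types X N : set G.

Definition is_submonoid X : Prop := monoid_closed [in X].
Definition is_subgroup X : Prop := group_closed [in X].
Definition is_normal_subgroup N : Prop :=
  is_subgroup N /\ forall x y : G, N x -> N (x ^ y).

Definition submonoid_gen X : set G := smallest is_submonoid X.
Definition subgroup_gen X : set G := smallest is_subgroup X.
Definition normal_closure X : set G := smallest is_normal_subgroup X.

Lemma normal_closureP X : is_normal_subgroup (normal_closure X).
Proof.
split; first split.
- by apply/mem_set => N [[[N1 _] _] _]; exact: set_mem N1.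
- move=> x y /set_mem Cx /set_mem Cy; apply/mem_set => N NX.
  have [[[_ Nd] _] _] := NX.
  by apply/set_mem/Nd; apply/mem_set; [exact: Cx | exact: Cy].
- move=> x y Cx N NX; have [[_ NJ] _] := NX.
  by apply: NJ; exact: Cx.
Qed.

End Subsets.

Definition infinite_cyclic (G : groupType) : Prop :=
  infinite_set [set: G] /\ exists g : G, subgroup_gen [set g] = [set: G].

Section QuotientByNormalClosure.
Variables (G : groupType) (X : set G).

Let N := normal_closure X.

Let N1 : N 1.
Proof. by have [[/set_mem]] := normal_closureP X. Qed.
Let NV x : N x -> N x^-1.
Proof.
move=> /mem_set Nx; have [Ng _] := normal_closureP X.
exact/set_mem/(group_closedV Ng).
Qed.
Let NM x y : N x -> N y -> N (x * y).
Proof.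
move=> /mem_set Nx /mem_set Ny; have [Ng _] := normal_closureP X.
by apply/set_mem/(group_closedM Ng).
Qed.
Let NJ x y : N x -> N (x ^ y).
Proof. by have [_] := normal_closureP X; apply. Qed.

Definition coset_rel (x y : G) : bool := `[< normal_closure X (x^-1 * y) >].

Lemma coset_rel_refl : reflexive coset_rel.
Proof. by move=> x; apply/asboolP; rewrite mulVg. Qed.

Lemma coset_rel_sym : symmetric coset_rel.
Proof.
move=> x y; apply/asboolP/asboolP => /NV; by rewrite invgM invgK.
Qed.

Lemma coset_rel_trans : transitive coset_rel.
Proof.
move=> y x z /asboolP xy /asboolP yz; apply/asboolP.
by have := NM xy yz; rewrite mulgA mulgK.
Qed.

Canonical coset_rel_equiv :=
  EquivRel coset_rel coset_rel_refl coset_rel_sym coset_rel_trans.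

Definition quot_ncl := {eq_quot coset_rel}.

HB.instance Definition _ := Choice.on quot_ncl.
HB.instance Definition _ := EqQuotient.on quot_ncl.

Definition quot_ncl_pi (x : G) : quot_ncl := \pi_quot_ncl x.

Definition quot_ncl_one : quot_ncl := quot_ncl_pi 1.
Definition quot_ncl_mul (p q : quot_ncl) : quot_ncl :=
  quot_ncl_pi (repr p * repr q).
Definition quot_ncl_inv (p : quot_ncl) : quot_ncl := quot_ncl_pi (repr p)^-1.

Lemma quot_ncl_piP (x y : G) :
  quot_ncl_pi x = quot_ncl_pi y <-> normal_closure X (x^-1 * y).
Proof.
split=> [/eqquotP/asboolP //|xy].
by apply/eqquotP/asboolP.
Qed.

Lemma quot_ncl_piK (p : quot_ncl) : quot_ncl_pi (repr p) = p.
Proof. exact: reprK. Qed.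

Lemma quot_ncl_piM (x y : G) :
  quot_ncl_pi (x * y) = quot_ncl_mul (quot_ncl_pi x) (quot_ncl_pi y).
Proof.
apply/quot_ncl_piP; set x' := repr (quot_ncl_pi x); set y' := repr _.
have /quot_ncl_piP xx' : quot_ncl_pi x = quot_ncl_pi x' by rewrite quot_ncl_piK.
have /quot_ncl_piP yy' : quot_ncl_pi y = quot_ncl_pi y' by rewrite quot_ncl_piK.
have := NM (NJ y xx') yy'.
by rewrite /conjg invgM !mulgA mulgK.
Qed.

Lemma quot_ncl_piV (x : G) :
  quot_ncl_pi x^-1 = quot_ncl_inv (quot_ncl_pi x).
Proof.
apply/quot_ncl_piP; set x' := repr _.
have /quot_ncl_piP xx' : quot_ncl_pi x = quot_ncl_pi x' by rewrite quot_ncl_piK.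
have := NJ x^-1 (NV xx').
by rewrite /conjg invgM !invgK !mulgA mulgK.
Qed.

Lemma quot_ncl_mulA : associative quot_ncl_mul.
Proof.
move=> p q r; rewrite -(quot_ncl_piK p) -(quot_ncl_piK q) -(quot_ncl_piK r).
by rewrite -!quot_ncl_piM mulgA.
Qed.

Lemma quot_ncl_mul1 : left_id quot_ncl_one quot_ncl_mul.
Proof.
by move=> p; rewrite -(quot_ncl_piK p) -quot_ncl_piM mul1g.
Qed.

Lemma quot_ncl_mulr1 : right_id quot_ncl_one quot_ncl_mul.
Proof.
by move=> p; rewrite -(quot_ncl_piK p) -quot_ncl_piM mulg1.
Qed.

Lemma quot_ncl_mulV : left_inverse quot_ncl_one quot_ncl_inv quot_ncl_mul.
Proof.
by move=> p; rewrite -(quot_ncl_piK p) -quot_ncl_piV -quot_ncl_piM mulVg.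
Qed.

Lemma quot_ncl_mulgV : right_inverse quot_ncl_one quot_ncl_inv quot_ncl_mul.
Proof.
by move=> p; rewrite -(quot_ncl_piK p) -quot_ncl_piV -quot_ncl_piM mulgV.
Qed.

HB.instance Definition _ := isGroup.Build quot_ncl
  quot_ncl_mulA quot_ncl_mul1 quot_ncl_mulr1 quot_ncl_mulV quot_ncl_mulgV.

End QuotientByNormalClosure.

Section FreeProduct.
Variables A B : groupType.

Local Notation word := (seq (A + B)).

(* The congruence on words over the disjoint union of A and B generated by    *)
(* the multiplication tables of A and of B.                                   *)
Inductive fprod_eq : word -> word -> Prop :=
| FprodRefl u : fprod_eq u u
| FprodSym u v : fprod_eq u v -> fprod_eq v u
| FprodTrans u v w : fprod_eq u v -> fprod_eq v w -> fprod_eq u w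
| FprodCat u u' v v' :
    fprod_eq u u' -> fprod_eq v v' -> fprod_eq (u ++ v) (u' ++ v')
| FprodOneL : fprod_eq [:: inl 1] [::]
| FprodOneR : fprod_eq [:: inr 1] [::]
| FprodMulL a a' : fprod_eq [:: inl a; inl a'] [:: inl (a * a')]
| FprodMulR b b' : fprod_eq [:: inr b; inr b'] [:: inr (b * b')].

Definition fprod_rel (u v : word) : bool := `[< fprod_eq u v >].

Lemma fprod_rel_refl : reflexive fprod_rel.
Proof. by move=> u; apply/asboolP; exact: FprodRefl. Qed.

Lemma fprod_rel_sym : symmetric fprod_rel.
Proof. by move=> u v; apply/asboolP/asboolP; exact: FprodSym. Qed.

Lemma fprod_rel_trans : transitive fprod_rel.
Proof.
by move=> v u w /asboolP uv /asboolP vw; apply/asboolP; exact: FprodTrans uv vw.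
Qed.

Canonical fprod_rel_equiv :=
  EquivRel fprod_rel fprod_rel_refl fprod_rel_sym fprod_rel_trans.

Definition free_product := {eq_quot fprod_rel}.

HB.instance Definition _ := Choice.on free_product.
HB.instance Definition _ := EqQuotient.on free_product.

Definition fprod_pi (u : word) : free_product := \pi_free_product u.

Definition letter_inv (x : A + B) : A + B :=
  match x with inl a => inl a^-1 | inr b => inr b^-1 end.
Definition fword_inv (u : word) : word := rev (map letter_inv u).

Definition fprod_one : free_product := fprod_pi [::].
Definition fprod_mul (p q : free_product) : free_product :=
  fprod_pi (repr p ++ repr q).
Definition fprod_inv (p : free_product) : free_product :=
  fprod_pi (fword_inv (repr p)).

Lemma fprod_piP (u v : word) : fprod_pi u = fprod_pi v <-> fprod_eq u v.
Proof.
split=> [/eqquotP/asboolP //|uv].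
by apply/eqquotP/asboolP.
Qed.

Lemma fprod_piK (p : free_product) : fprod_pi (repr p) = p.
Proof. exact: reprK. Qed.

Lemma fprod_piM (u v : word) :
  fprod_pi (u ++ v) = fprod_mul (fprod_pi u) (fprod_pi v).
Proof. by apply/fprod_piP/FprodCat; apply/fprod_piP; rewrite fprod_piK. Qed.

Lemma fword_inv_eq (u v : word) :
  fprod_eq u v -> fprod_eq (fword_inv u) (fword_inv v).
Proof.
rewrite /fword_inv; elim=> {u v} /=.
- by move=> u; exact: FprodRefl.
- by move=> u v _; exact: FprodSym.
- by move=> u v w _ uv _; exact: FprodTrans.
- by move=> u u' v v' _ uu' _ vv'; rewrite !map_cat !rev_cat; exact: FprodCat.
- by rewrite invg1; exact: FprodOneL.
- by rewrite invg1; exact: FprodOneR.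
- by move=> a a'; rewrite invgM; exact: FprodMulL.
- by move=> b b'; rewrite invgM; exact: FprodMulR.
Qed.

Lemma fprod_piV (u : word) : fprod_pi (fword_inv u) = fprod_inv (fprod_pi u).
Proof. by apply/fprod_piP/fword_inv_eq/fprod_piP; rewrite fprod_piK. Qed.

Lemma fword_invK : involutive fword_inv.
Proof.
move=> u; rewrite /fword_inv map_rev revK -map_comp.
by rewrite -[RHS]map_id; apply: eq_map => -[x|x] /=; rewrite invgK.
Qed.

Lemma fword_invV (u : word) : fprod_eq (fword_inv u ++ u) [::].
Proof.
elim: u => [|x u IHu]; first exact: FprodRefl.
rewrite /fword_inv /= rev_cons -/(fword_inv u) cat_rcons.
apply: FprodTrans IHu; apply: FprodCat; first exact: FprodRefl.
rewrite -[_ :: _ :: u]/([:: letter_inv x; x] ++ u).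
rewrite -[X in fprod_eq _ X]/([::] ++ u).
apply: FprodCat; last exact: FprodRefl.
case: x => x /=.
- by apply: FprodTrans (FprodMulL _ _) _; rewrite mulVg; exact: FprodOneL.
- by apply: FprodTrans (FprodMulR _ _) _; rewrite mulVg; exact: FprodOneR.
Qed.

Lemma fprod_mulA : associative fprod_mul.
Proof.
move=> p q r; rewrite -(fprod_piK p) -(fprod_piK q) -(fprod_piK r).
by rewrite -!fprod_piM catA.
Qed.

Lemma fprod_mul1 : left_id fprod_one fprod_mul.
Proof. by move=> p; rewrite -(fprod_piK p) -fprod_piM. Qed.

Lemma fprod_mulr1 : right_id fprod_one fprod_mul.
Proof. by move=> p; rewrite -(fprod_piK p) -fprod_piM cats0. Qed.

Lemma fprod_mulV : left_inverse fprod_one fprod_inv fprod_mul.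
Proof.
move=> p; rewrite -(fprod_piK p) -fprod_piV -fprod_piM.
exact/fprod_piP/fword_invV.
Qed.

Lemma fprod_mulgV : right_inverse fprod_one fprod_inv fprod_mul.
Proof.
move=> p; rewrite -(fprod_piK p) -fprod_piV -fprod_piM.
by apply/fprod_piP; rewrite -{1}[repr p]fword_invK; exact: fword_invV.
Qed.

HB.instance Definition _ := isGroup.Build free_product
  fprod_mulA fprod_mul1 fprod_mulr1 fprod_mulV fprod_mulgV.

Definition fprod_inl (a : A) : free_product := fprod_pi [:: inl a].
Definition fprod_inr (b : B) : free_product := fprod_pi [:: inr b].

(* The convention is [h, k] = h k h^-1 k^-1, not the [~ h, k] of monoid.v.   *)
Definition cross_commutators (H : set A) (K : set B) : set free_product :=
  [set c | exists h k, [/\ H h, K k & c =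
     fprod_inl h * fprod_inr k * (fprod_inl h)^-1 * (fprod_inr k)^-1]].

Definition fprod_commuting (H : set A) (K : set B) : groupType :=
  quot_ncl (cross_commutators H K).

End FreeProduct.

(* Kleene's partial recursive functions of a given arity.                     *)
Inductive recfun : nat -> Type :=
| RZero n : recfun n
| RSucc : recfun 1
| RProj n (i : 'I_n) : recfun n
| RComp m n (f : recfun m) (g : 'I_m -> recfun n) : recfun n
| RPrim n (f : recfun n) (g : recfun n.+2) : recfun n.+1
| RMin n (f : recfun n.+1) : recfun n.

Fixpoint prim_rec n (f : n.-tuple nat -> nat -> Prop)
    (g : n.+2.-tuple nat -> nat -> Prop) (xs : n.-tuple nat) (k : nat) :
    nat -> Prop :=
  if k is k'.+1 then fun y =>
    exists2 z, prim_rec f g xs k' z & g [tuple of k' :: z :: xs] y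
  else f xs.

(* [rec_eval f xs y]: f is defined at xs, with value y.                       *)
Fixpoint rec_eval n (f : recfun n) : n.-tuple nat -> nat -> Prop :=
  match f in recfun n return n.-tuple nat -> nat -> Prop with
  | RZero n => fun _ y => y = 0%N
  | RSucc => fun xs y => y = (thead xs).+1
  | RProj n i => fun xs y => y = tnth xs i
  | RComp m n f g => fun xs y =>
      exists2 zs : m.-tuple nat,
        forall i, rec_eval (g i) xs (tnth zs i) & rec_eval f zs y
  | RPrim n f g => fun xs =>
      prim_rec (rec_eval f) (rec_eval g) [tuple of behead xs] (thead xs)
  | RMin n f => fun xs y =>
      rec_eval f [tuple of y :: xs] 0 /\
      forall z, (z < y)%N -> exists v, rec_eval f [tuple of z :: xs] v.+1
  end.

(* The problem P, whose instances x are presented to algorithms as the        *)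
(* numbers [code x], is decided by a recursive function.                      *)
Definition recursively_decidable (I : Type) (code : I -> nat) (P : I -> Prop) :=
  exists f : recfun 1, forall x : I,
    exists2 b : bool, rec_eval f [tuple code x] b & (b <-> P x).

Section SubmonoidMembership.
Variables (G : groupType) (k : nat) (S : k.-tuple G).

(* The letter (i, false) is the i-th generator, (i, true) its inverse.        *)
Definition sword := seq ('I_k * bool).

Definition sword_val (w : sword) : G :=
  \prod_(l <- w) (if l.2 then (tnth S l.1)^-1 else tnth S l.1).

Definition submonoid_membership (inst : sword * seq sword) : Prop :=
  submonoid_gen [set sword_val w | w in [set` inst.2]] (sword_val inst.1).

(* CodeSeq.code is an effective bijection from seq nat to nat, so instances   *)
(* are coded injectively and effectively.                                     *)
Definition sword_code (w : sword) : nat :=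
  CodeSeq.code [seq (l.1.*2 + l.2)%N | l : 'I_k * bool <- w].

Definition instance_code (inst : sword * seq sword) : nat :=
  CodeSeq.code (sword_code inst.1 :: [seq sword_code w | w <- inst.2]).

End SubmonoidMembership.

Definition generates (G : groupType) k (S : k.-tuple G) : Prop :=
  subgroup_gen [set` S] = [set: G].

(* G is finitely generated, and the problem is undecidable with respect to    *)
(* every finite generating family (as is well known, this does not depend on  *)
(* the family).                                                               *)
Definition submonoid_membership_undecidable (G : groupType) : Prop :=
  (exists k (S : k.-tuple G), generates S) /\
  forall k (S : k.-tuple G), generates S ->
    ~ recursively_decidable (@instance_code k) (submonoid_membership S).

(* Main.v *)
Require Import Defs.
From HB Require Import structures.
From mathcomp Require Import all_boot.
From mathcomp Require Import order ssralg ssrnum ssrint zify.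
From mathcomp Require Import boolp classical_sets cardinality.

(** The group is G = < a, b | [a^2, b^2] >.  Conjugating a^2 and b^2 by the
    alternating words 1, a, ab, aba, ... gives an infinite sequence of elements
    v_0, v_1, v_2, ... of G in which consecutive ones commute
    ([vertex_commute]).  The first four of them, written alpha, x, y, delta,
    carry a computation on a single natural number N, the exponent of x; other
    v_i, pairwise non-adjacent and far from these four, serve as control letters.

    A step of the computation applies a rule (p, a, p', a'), which sends
    p j + a to p' j + a'.  With N = p j + a and N' = p' j + a', the group
    performs it through the identity [transfer_product]:
    x^N . alpha . x^-a y^a' (x^-p y^p')^j . delta . (y^-1 x)^N' =
    (alpha delta) x^N'.  Here alpha can pass the power of x because no y is
    present, and delta can pass the power of y because x is used up.  A control
    letter s_c for each state c of a finite automaton, and generators of the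
    form s_c^-1 g s_c', make a product of generators follow the automaton; a
    final phase removes the remaining power of x and the record
    (alpha delta)^t of the t steps made.  So a halting computation started at N
    puts the element s_Start^-1 x^-N s_Erase in the submonoid
    ([membership_complete]).

    For the converse ([membership_sound]), G acts on T * nat as soon as
    permutations of a set T are given in which consecutive ones commute, and
    v_i acts on T * 0 as the i-th of them ([submonoid_invariant]).  A small
    choice suffices.  On triples (i, j, h) of integers x and y translate i and j,
    alpha adds 1 to h unless j = 0, and delta adds 1 to h unless i = 0: a
    wrongly counted transfer makes h positive, and it stays so up to the erasing
    phase, during which h does not change if the product ends at i = j = 0.  The
    control letters move points along the lines of a star, and x, y, alpha, delta
    act only at its centre; this is enough to confine products of generators
    to the paths of the automaton ([edge_invariant]).

    Every partial recursive function is computed by such rules: it is compiled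
    to a program on registers ([compile_correct]), whose store is then kept as
    one number with the registers as exponents of distinct primes
    ([machine_of_recfun]).

    Undecidability follows by a diagonal argument.  From a recursive decision
    function one obtains a recursive function that, on input d, answers whether
    the target word for 2^d lies in the submonoid generated by the list of words
    coded by d.  A machine that halts on d exactly when this answer is negative
    yields a list of words such that the target word for 2^d lies in their
    submonoid exactly when the machine halts on d; taking for d the code of this
    very list is contradictory ([undecidable_membership]). *)

Set Implicit Arguments.
Unset Strict Implicit.
Unset Printing Implicit Defensive.

(** * Register programs *)

Inductive reach (T : Type) (R : T -> T -> Prop) : T -> T -> Prop :=
| ReachRefl x : reach R x x
| ReachStep x y z : R x y -> reach R y z -> reach R x z.
Arguments ReachRefl {T R}.

Lemma reach_trans T (R : T -> T -> Prop) x y z :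
  reach R x y -> reach R y z -> reach R x z.
Proof. by elim=> // x1 y1 z1 Rxy _ IH /IH; apply: ReachStep. Qed.

(** Nondeterministic programs with relational semantics.  Decrementing an empty
    register and the failed test for zero block, so that loops and branches are
    obtained from the Kleene star alone. *)
Inductive instr := Nop | Inc of nat | Dec of nat | Zero of nat.
Inductive prog := Do of instr | Seq of prog & prog | Star of prog.

Definition store := nat -> nat.
Definition upd (s : store) i v : store := fun j => if j == i then v else s j.

Lemma updE s i v j : upd s i v j = if j == i then v else s j.
Proof. by []. Qed.

Definition exec (c : instr) (s s' : store) : Prop :=
  match c with
  | Nop => s' = s
  | Inc i => s' = upd s i (s i).+1
  | Dec i => 0 < s i /\ s' = upd s i (s i).-1
  | Zero i => s i = 0 /\ s' = s
  end.

Fixpoint run (e : prog) : store -> store -> Prop :=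
  match e with
  | Do c => exec c
  | Seq e1 e2 => fun s s' => exists2 t, run e1 s t & run e2 t s'
  | Star e => reach (run e)
  end.

Definition while i e := Seq (Star (Seq (Do (Dec i)) e)) (Do (Zero i)).

Lemma run_while i e s s' : run (while i e) s s' <->
  if s i is n.+1 then exists2 t, run e (upd s i n) t & run (while i e) t s'
  else s' = s.
Proof.
split.
- case=> t /= runs [+ ->]; case: runs => [{}t ->|{}s t1 {}t [t2 [+ ->] run1] runs ti0] //.
  by case: (s i) run1 => // n run1 _; exists t1 => //; exists t.
- case si: (s i) => [|n]; first by move=> ->; exists s => //; exact: ReachRefl.
  case=> t run_e [u run_t run_u]; exists u => //.
  apply: (ReachStep _ run_t); exists (upd s i n) => //; rewrite /= si //.
Qed.

Definition drain i j := while i (Do (Inc j)).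
Definition drain2 i j l := while i (Seq (Do (Inc j)) (Do (Inc l))).
Definition clear i := while i (Do Nop).
(* The register l is used as a buffer, emptied back into i. *)
Definition copy i j l := Seq (drain2 i j l) (drain l i).

Ltac store_eq := apply: funext => ?; rewrite /upd; repeat case: eqP => ?; subst; try lia.

(** When the body is a function f that leaves the counter i alone, the loop
    computes the function F determined by the two unrolling equations. *)
Lemma run_for i e (f F : store -> store) :
  (forall s s', run e s s' <-> s' = f s) ->
  (forall s, f s i = s i) ->
  (forall s, s i = 0 -> F s = s) ->
  (forall s n, s i = n.+1 -> F s = F (f (upd s i n))) ->
  forall s s', run (while i e) s s' <-> s' = F s.
Proof.
move=> run_e fi F0 FS s.
elim: {s}(s i) {-2}s (erefl (s i)) => [|n IHn] s si s'; rewrite run_while si.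
  by rewrite F0.
rewrite (FS _ _ si) -IHn; last by rewrite fi /upd eqxx.
by split=> [[t /run_e ->]|]; last by exists (f (upd s i n)) => //; apply/run_e.
Qed.

Lemma run_clear i s s' : run (clear i) s s' <-> s' = upd s i 0.
Proof.
by move: s s'; apply: (@run_for _ _ id) => // s *; store_eq.
Qed.

Lemma run_drain i j s s' : i != j ->
  run (drain i j) s s' <-> s' = upd (upd s j (s j + s i)) i 0.
Proof.
move=> ij; move: s s'; apply: (@run_for _ _ (fun s => upd s j (s j).+1)) => // s *.
- by rewrite /upd (negPf ij).
- store_eq.
- store_eq.
Qed.

Lemma run_drain2 i j l s s' : i != j -> i != l -> j != l ->
  run (drain2 i j l) s s' <->
  s' = upd (upd (upd s j (s j + s i)) l (s l + s i)) i 0.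
Proof.
move=> ij il jl; move: s s'.
apply: (@run_for _ _ (fun s => upd (upd s j (s j).+1) l (s l).+1)) => [s s'||s *|s *].
- split=> [[t -> ->]|->]; last exists (upd s j (s j).+1) => //=;
  by rewrite /upd eq_sym (negPf jl).
- by move=> s; rewrite /upd (negPf ij) (negPf il).
- store_eq.
- store_eq.
Qed.

Lemma run_copy i j l s s' : i != j -> i != l -> j != l -> s l = 0 ->
  run (copy i j l) s s' <-> s' = upd s j (s j + s i).
Proof.
move=> ij il jl sl; pose t := upd (upd (upd s j (s j + s i)) l (s l + s i)) i 0.
have tE : upd s j (s j + s i) = upd (upd t i (t i + t l)) l 0 by rewrite /t; store_eq.
rewrite tE -run_drain 1?eq_sym //.
by split=> [[u /run_drain2 ->]|] //; exists t => //; apply/run_drain2.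
Qed.

(** * Compiling recursive functions *)

Definition seqs := foldr Seq (Do Nop).

(** [compile f ins out k] puts the value of f at the registers ins into the
    register out, initially 0, with the registers from k on as working space.  In the case of
    [RPrim], k holds the index, k.+1 the number of remaining rounds, k.+2 the next
    value, and out the current one; in the case of [RMin], out is itself the
    candidate, and the nonzero value of f at it is found in k. *)
Fixpoint compile n (f : recfun n) : n.-tuple nat -> nat -> nat -> prog :=
  match f in recfun n return n.-tuple nat -> nat -> nat -> prog with
  | RZero n => fun _ _ _ => Do Nop
  | RSucc => fun ins out k => Seq (copy (thead ins) out k) (Do (Inc out))
  | RProj n i => fun ins out k => copy (tnth ins i) out k
  | RComp m n f g => fun ins out k =>
      Seq (seqs [seq compile (g i) ins (k + i) (k + m) | i <- enum 'I_m])
        (Seq (compile f [tuple k + i | i < m] out (k + m))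
             (seqs [seq clear (k + (i : 'I_m)) | i <- enum 'I_m]))
  | RPrim n f g => fun ins out k =>
      Seq (copy (thead ins) k.+1 k.+2)
        (Seq (compile f [tuple of behead ins] out k.+3)
          (Seq (while k.+1
                 (Seq (compile g [tuple of k :: out :: behead ins] k.+2 k.+3)
                   (Seq (clear out) (Seq (drain k.+2 out) (Do (Inc k))))))
               (clear k)))
  | RMin n f => fun ins out k =>
      let call := compile f [tuple of out :: ins] k k.+1 in
      Seq (Star (Seq call (Seq (Do (Dec k)) (Seq (clear k) (Do (Inc out))))))
          (Seq call (Do (Zero k)))
  end.

Definition ready n (ins : n.-tuple nat) out k (s : store) :=
  [/\ all (ltn^~ k) ins, out < k, out \notin ins, s out = 0
    & forall i, k <= i -> s i = 0].

(** The equivalence says at once that the program can end only with the right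
    value, that it can end if there is one, and that inputs and working space are
    restored, which is what makes programs composable. *)
Definition compiles n (f : recfun n) := forall ins out k s s',
  ready ins out k s ->
  run (compile f ins out k) s s' <->
  exists2 y, rec_eval f [tuple of map s ins] y & s' = upd s out y.

Lemma map_tuple_eq n (ins : n.-tuple nat) (s t : store) :
  {in ins, s =1 t} -> [tuple of map s ins] = [tuple of map t ins].
Proof. by move=> st; apply: val_inj; apply/eq_in_map. Qed.

Lemma ready_in n (ins : n.-tuple nat) out k s (i : nat) :
  ready ins out k s -> i \in ins -> i < k /\ i != out.
Proof.
case=> /allP lt_ins _ out_ins _ _ ii; split; first exact: lt_ins.
by apply: contraNneq out_ins => <-.
Qed.

Lemma compile_zero n : compiles (RZero n).
Proof.
move=> ins out k s s' [_ _ _ s0 _] /=.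
have e : upd s out 0 = s by store_eq.
by split=> [->|[y ->]]; [exists 0|]; rewrite ?e.
Qed.

Lemma run_fetch n (ins : n.-tuple nat) out k s s' (i : nat) : ready ins out k s ->
  i \in ins -> run (copy i out k) s s' <-> s' = upd s out (s i).
Proof.
move=> rdy /(ready_in rdy) [ik io]; have [_ ok _ s0 sk] := rdy.
by rewrite run_copy ?s0 ?(sk k) //; lia.
Qed.

Lemma compile_proj n (i : 'I_n) : compiles (RProj i).
Proof.
move=> ins out k s s' rdy; rewrite [compile _ _ _ _]/= (run_fetch _ rdy) ?mem_tnth //=.
by rewrite tnth_map; split=> [->|[y -> ->]] //; exists (s (tnth ins i)).
Qed.

Lemma compile_succ : compiles RSucc.
Proof.
move=> ins out k s s' rdy.
have runE t : run (copy (thead ins) out k) s t <-> t = upd s out (s (thead ins)).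
  by rewrite (run_fetch _ rdy) ?mem_tnth.
rewrite /= -/(run _).
have -> : thead [tuple of map s ins] = s (thead ins) by rewrite /thead tnth_map.
split=> [[t /runE -> ->]|[y -> ->]].
  by exists (s (thead ins)).+1 => //; rewrite updE eqxx; store_eq.
by exists (upd s out (s (thead ins))); [exact/runE | rewrite updE eqxx; store_eq].
Qed.

Lemma compile_min n (f : recfun n.+1) : compiles f -> compiles (RMin f).
Proof.
move=> IHf ins out k s s' rdy /=; have [_ ltk out_ins s0 sk] := rdy.
have lt_ins i (ii : i \in ins) := proj1 (ready_in rdy ii).
have sk0 := sk k (leqnn k).
have callE y t : run (compile f [tuple of out :: ins] k k.+1) (upd s out y) t <->
    exists2 v, rec_eval f [tuple of y :: map s ins] v & t = upd (upd s out y) k v.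
  rewrite IHf; last first.
    split.
    - by rewrite /= ltnS ltnW //; apply/allP => i /lt_ins; lia.
    - by [].
    - by rewrite inE negb_or; apply/andP; split; [lia|apply/negP => /lt_ins; lia].
    - by rewrite updE sk //; case: eqP; lia.
    - by move=> i ki; rewrite updE sk //; [case: eqP; lia|lia].
  suff -> : [tuple of map (upd s out y) (out :: ins)] = [tuple of y :: map s ins] by [].
  apply: val_inj => /=; rewrite updE eqxx; congr (_ :: _).
  by apply/eq_in_map => i ii; rewrite updE; case: eqP ii out_ins => // -> ->.
have bodyE y t : run (Seq (compile f [tuple of out :: ins] k k.+1)
      (Seq (Do (Dec k)) (Seq (clear k) (Do (Inc out))))) (upd s out y) t <->
    (exists v, rec_eval f [tuple of y :: map s ins] v.+1) /\ t = upd s out y.+1.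
  split.
    case=> u /callE [v fv ->] [w [+ ->] [x /run_clear -> ->]].
    rewrite updE eqxx; case: v fv => // v fv _; split; first by exists v.
    by store_eq.
  case=> [[v fv] ->]; exists (upd (upd s out y) k v.+1); first by apply/callE; exists v.+1.
  exists (upd (upd s out y) k v); first by split; rewrite updE eqxx //; store_eq.
  exists (upd (upd s out y) k 0); first by apply/run_clear; store_eq.
  by store_eq.
rewrite -/(run (Star _)) /=.
have e0 : s = upd s out 0 by store_eq.
have starE y t : reach (run (Seq (compile f [tuple of out :: ins] k k.+1)
      (Seq (Do (Dec k)) (Seq (clear k) (Do (Inc out)))))) (upd s out y) t <->
    exists2 z, y <= z & t = upd s out z /\ forall w, y <= w < z ->
       exists v, rec_eval f [tuple of w :: map s ins] v.+1.
  split.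
    move eu: (upd s out y) => u r; elim: r y eu => {u t} [u y <-|u t w + _ IH y eu].
      by exists y => //; split=> // z; lia.
    rewrite -eu => /bodyE [[v fv]] /esym /IH [z yz [-> zw]]; exists z; first lia.
    split=> // x; case: (eqVneq x y) => [->|xy xx]; first by exists v.
    by apply: zw; lia.
  case=> z yz [-> H]; move: yz H; move dz: (z - y) => d.
  elim: d y dz => [|d IH] y dz yz H.
    by have -> : z = y by [lia]; apply: ReachRefl.
  apply: (ReachStep (y := upd s out y.+1)).
    by apply/bodyE; split=> //; apply: H; lia.
  by apply: IH; try lia; move=> w ?; apply: H; lia.
split.
  case=> t; rewrite {1}e0 => /starE [y _ [-> H]] [u /callE [v fv ->] [+ ->]].
  rewrite updE eqxx => v0; subst v; exists y; last by store_eq.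
  by split=> // z zy; apply: H; lia.
case=> y [fy H] ->; exists (upd s out y).
  by rewrite {1}e0; apply/starE; exists y => //; split=> // z ?; apply: H; lia.
exists (upd (upd s out y) k 0); first by apply/callE; exists 0.
by rewrite updE eqxx; split=> //; store_eq.
Qed.

(** The loop of [compile_prim] goes upwards from index t, whereas [prim_rec]
    recurses downwards; [prim_rec_chain] relates the two. *)
Fixpoint chain (G : nat -> nat -> nat -> Prop) t z c z' : Prop :=
  if c is c'.+1 then exists2 w, G t z w & chain G t.+1 w c' z' else z' = z.

Lemma prim_rec_chain n f (g : n.+2.-tuple nat -> nat -> Prop) (xs : n.-tuple nat) t c z' :
  prim_rec f g xs (t + c) z' <-> exists2 z, prim_rec f g xs t z &
    chain (fun i z w => g [tuple of i :: z :: xs] w) t z c z'.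
Proof.
elim: c t z' => [|c IH] t z' /=.
  by rewrite addn0; split=> [|[z + ->]] //; exists z'.
rewrite -addSnnS IH; split=> [[w [z fz gw] ch]|[z fz [w gw ch]]].
  by exists z => //; exists w.
by exists w => //; exists z.
Qed.

Lemma compile_prim n (f : recfun n) (g : recfun n.+2) :
  compiles f -> compiles g -> compiles (RPrim f g).
Proof.
move=> IHf IHg ins out k s s' rdy; have [_ ltk out_ins s0 sk] := rdy.
have lt_ins (i : nat) (ii : i \in ins) := proj1 (ready_in rdy ii).
have [sk0 sk1 sk2] : [/\ s k = 0, s k.+1 = 0 & s k.+2 = 0] by split; apply: sk; lia.
pose x0 := s (thead ins).
(* The store at the head of the loop: index t, value z, c rounds to go. *)
pose L t z c := upd (upd (upd s out z) k t) k.+1 c.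
pose xs := [tuple of behead [tuple of map s ins]].
have behE : behead (map s ins) = map s (behead ins) by case: (tval ins).
have copyE t : run (copy (thead ins) k.+1 k.+2) s t <-> t = upd s k.+1 x0.
  have hk : thead ins < k := lt_ins _ (mem_tnth ord0 ins).
  by rewrite run_copy ?sk1 ?sk2 //; lia.
have callf t : run (compile f [tuple of behead ins] out k.+3) (upd s k.+1 x0) t <->
    exists2 z, rec_eval f xs z & t = L 0 z x0.
  rewrite IHf; last first.
    split=> //.
    - by apply/allP => i /mem_behead /lt_ins /=; lia.
    - lia.
    - by apply: contra out_ins => /mem_behead.
    - by rewrite updE s0; case: eqP => //; lia.
    - by move=> i ki; rewrite updE sk; [case: eqP; lia|lia].
  have -> : [tuple of map (upd s k.+1 x0) [tuple of behead ins]] = xs.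
    apply: val_inj; rewrite /= behE; apply/eq_in_map => i /mem_behead /lt_ins ik.
    by rewrite updE; case: eqP => //; lia.
  by split=> -[z fz ->]; exists z => //; rewrite /L; store_eq.
have callg t z c t' :
    run (compile g [tuple of k :: out :: behead ins] k.+2 k.+3) (L t z c) t' <->
    exists2 w, rec_eval g [tuple of t :: z :: xs] w & t' = upd (L t z c) k.+2 w.
  rewrite IHg; last first.
    split=> //.
    - by apply/allP => i; rewrite !inE => /or3P[/eqP->|/eqP->|/mem_behead /lt_ins] /=; lia.
    - rewrite !inE !negb_or; apply/and3P; split; try lia.
      by apply/negP => /mem_behead /lt_ins; lia.
    - by rewrite /L !updE sk2; repeat case: eqP => ?; lia.
    - by move=> i ki; rewrite /L !updE sk; [repeat case: eqP => ?; lia|lia].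
  suff -> : [tuple of map (L t z c) [tuple of k :: out :: behead ins]] =
            [tuple of t :: z :: xs] by [].
  apply: val_inj; rewrite /= behE; congr [:: _, _ & _].
  - by rewrite /L !updE; repeat case: eqP => ?; lia.
  - by rewrite /L !updE; repeat case: eqP => ?; lia.
  apply/eq_in_map => i /mem_behead ii; have [ik io] := ready_in rdy ii.
  by rewrite /L !updE (negPf io); repeat case: eqP => ?; lia.
pose body := Seq (compile g [tuple of k :: out :: behead ins] k.+2 k.+3)
                 (Seq (clear out) (Seq (drain k.+2 out) (Do (Inc k)))).
have bodyE t z c t' : run body (L t z c) t' <->
    exists2 w, rec_eval g [tuple of t :: z :: xs] w & t' = L t.+1 w c.
  have ne : k.+2 != out by lia.
  have tailE w u : run (Seq (clear out) (Seq (drain k.+2 out) (Do (Inc k))))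
      (upd (L t z c) k.+2 w) u <-> u = L t.+1 w c.
    split.
      case=> u1 /run_clear -> [u2 /(run_drain _ _ ne) ->].
      by move=> ->; rewrite /L; store_eq.
    move=> ->; exists (upd (upd (L t z c) k.+2 w) out 0); first exact/run_clear.
    exists (L t w c); first by apply/(run_drain _ _ ne); rewrite /L; store_eq.
    by rewrite /= /L; store_eq.
  split=> [[u /callg [w gw ->] /tailE ->]|[w gw ->]]; first by exists w.
  by exists (upd (L t z c) k.+2 w); [apply/callg; exists w|exact/tailE].
have loopE c t z t' : run (while k.+1 body) (L t z c) t' <->
    exists2 z', chain (fun i z w => rec_eval g [tuple of i :: z :: xs] w) t z c z'
              & t' = L (t + c) z' 0.
  elim: c t z t' => [|c IH] t z t'; rewrite run_while {1}/L updE eqxx.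
    by rewrite addn0; split=> [->|[_ -> ->]] //; exists z.
  have -> : upd (L t z c.+1) k.+1 c = L t z c by rewrite /L; store_eq.
  split=> [[u /bodyE [w gw ->] /IH [z' ch ->]]|[z' /= [w gw ch] ->]].
    by exists z'; [exists w|rewrite addSnnS].
  exists (L t.+1 w c); first by apply/bodyE; exists w.
  by apply/IH; exists z'; rewrite ?addSnnS.
have hd : thead [tuple of map s ins] = x0 by rewrite /thead tnth_map.
change (run _ _ _) with (run (Seq (copy (thead ins) k.+1 k.+2)
        (Seq (compile f [tuple of behead ins] out k.+3)
          (Seq (while k.+1 body) (clear k)))) s s').
change (rec_eval (RPrim f g) _) with
  (prim_rec (rec_eval f) (rec_eval g) xs (thead [tuple of map s ins])).
rewrite hd -[x0]add0n; split.
  case=> _ /copyE -> [_ /callf [z fz ->] [_ /loopE [z' ch ->] /run_clear ->]].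
  by exists z'; [apply/prim_rec_chain; exists z|rewrite /L; store_eq].
case=> z' /prim_rec_chain [z fz ch] ->.
exists (upd s k.+1 x0); first exact/copyE.
exists (L 0 z x0); first by apply/callf; exists z.
exists (L (0 + x0) z' 0); first by apply/loopE; exists z'.
by apply/run_clear; rewrite /L; store_eq.
Qed.

(** Stores agreeing with s except on the block of m registers starting at k,
    where the cells listed in r hold the values z. *)
Definition fill m k (z : 'I_m -> nat) (r : seq 'I_m) (s : store) : store :=
  foldr (fun (i : 'I_m) t => upd t (k + i) (z i)) s r.

Lemma fill_in m k (z : 'I_m -> nat) r s (i : 'I_m) :
  fill k z r s (k + i) = if i \in r then z i else s (k + i).
Proof.
elim: r => //= j r IH; rewrite updE inE eqn_add2l -val_eqE /= IH.
by case: eqP => //= /val_inj ->.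
Qed.

Lemma fill_out m k (z : 'I_m -> nat) r s j : ~~ (k <= j < k + m) -> fill k z r s j = s j.
Proof.
by move=> H; elim: r => //= i r <-; rewrite updE; case: eqP => // ?; have := ltn_ord i; lia.
Qed.

Lemma fill_upd m k (z : 'I_m -> nat) r s (i : 'I_m) y : i \notin r ->
  fill k z r (upd s (k + i) y) = fill k (fun j => if j == i then y else z j) (i :: r) s.
Proof.
move=> ir; apply: funext => j; case: (boolP (k <= j < k + m)) => kj.
  have jm : j - k < m by lia.
  have -> : j = k + Ordinal jm by rewrite /=; lia.
  rewrite !fill_in inE updE eqn_add2l -(val_eqE (Ordinal jm) i).
  by case: eqP => [/val_inj|] //= ->; rewrite (negPf ir).
rewrite !fill_out // updE; case: eqP => // ji; have := ltn_ord i; lia.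
Qed.

Lemma run_clear_seqs m k (r : seq 'I_m) s s' : uniq r ->
  run (seqs [seq clear (k + i) | i : 'I_m <- r]) s s' <-> s' = fill k (fun=> 0) r s.
Proof.
elim: r s s' => [|i r IH] s s' //= /andP[ir ur].
have e : fill k (fun=> 0) r (upd s (k + i) 0) = upd (fill k (fun=> 0) r s) (k + i) 0.
  by rewrite fill_upd // /= eqxx; congr (upd (fill _ _ _ _) _ _); apply: funext => j; case: eqP.
rewrite -e; split=> [[t /run_clear -> /(IH _ _ ur) ->]|->] //.
by exists (upd s (k + i) 0); [exact/run_clear|exact/(IH _ _ ur)].
Qed.

Lemma compile_comp m n (f : recfun m) (g : 'I_m -> recfun n) :
  compiles f -> (forall i, compiles (g i)) -> compiles (RComp f g).
Proof.
move=> IHf IHg ins out k s s' rdy; have [_ ltk out_ins s0 sk] := rdy.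
have lt_ins (i : nat) (ii : i \in ins) := proj1 (ready_in rdy ii).
have argsE r t t' : uniq r -> {in gtn k, s =1 t} ->
   (forall i : 'I_m, i \in r -> t (k + i) = 0) ->
   (forall i, k + m <= i -> t i = 0) ->
   run (seqs [seq compile (g i) ins (k + i) (k + m) | i <- r]) t t' <->
   exists2 z : 'I_m -> nat, (forall i, i \in r -> rec_eval (g i) [tuple of map s ins] (z i))
       & t' = fill k z r t.
  elim: r t t' => [|i r IH] t t' /=.
    by move=> _ *; split=> [->|[z]] //; exists (fun=> 0).
  case/andP=> ir ur st tr tm.
  have callE u : run (compile (g i) ins (k + i) (k + m)) t u <->
      exists2 y, rec_eval (g i) [tuple of map s ins] y & u = upd t (k + i) y.
    rewrite IHg; last first.
      split; last by [].
      - by apply/allP => j /lt_ins /=; lia.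
      - by rewrite ltn_add2l.
      - by apply/negP => /lt_ins; lia.
      - by apply: tr; rewrite inE eqxx.
    rewrite (@map_tuple_eq _ ins t s) // => j /lt_ins jk; exact/esym/st.
  have IHu y u :
     run (seqs [seq compile (g i) ins (k + i) (k + m) | i <- r]) (upd t (k + i) y) u <->
     exists2 z : 'I_m -> nat, (forall i, i \in r -> rec_eval (g i) [tuple of map s ins] (z i))
       & u = fill k z r (upd t (k + i) y).
    apply: IH => //.
    - by move=> j; rewrite inE => jk; rewrite updE st ?inE //; case: eqP => //; lia.
    - move=> j jr; rewrite updE eqn_add2l val_eqE tr ?inE ?jr ?orbT //.
      by case: eqP ir jr => // -> /negP.
    - by move=> j kj; rewrite updE tm //; case: eqP => //; have := ltn_ord i; lia.
  split.
    case=> u /callE [y gy ->] /IHu [z gz ->].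
    exists (fun j => if j == i then y else z j); last by rewrite fill_upd.
    by move=> j; rewrite inE; case: eqP => //= [->|_ /gz].
  case=> z gz ->; exists (upd t (k + i) (z i)).
    by apply/callE; exists (z i) => //; apply: gz; rewrite inE eqxx.
  apply/IHu; exists z; first by move=> j jr; apply: gz; rewrite inE jr orbT.
  rewrite fill_upd // /fill /=; congr (upd _ _ _) ; last by rewrite eqxx.
  elim: {IH IHu ur tr gz}r ir => //= j r IH.
  by rewrite inE negb_or eq_sym => /andP[/negPf -> /IH ->].
have {}argsE t' := argsE (enum 'I_m) s t' (enum_uniq _) (fun _ _ => erefl)
  (fun i _ => sk _ (leq_addr i k)) (fun i ki => sk _ (leq_trans (leq_addr m k) ki)).
have callE (z : 'I_m -> nat) t' :
    run (compile f [tuple k + i | i < m] out (k + m)) (fill k z (enum 'I_m) s) t' <->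
    exists2 y, rec_eval f [tuple z i | i < m] y & t' = upd (fill k z (enum 'I_m) s) out y.
  have -> : [tuple z i | i < m] =
    [tuple of map (fill k z (enum 'I_m) s) [tuple k + i | i < m]].
    apply: eq_from_tnth => i; rewrite tnth_map !tnth_mktuple fill_in mem_enum //.
  apply: IHf; split.
  - by apply/allP => _ /mapP[i _ ->]; rewrite /= ltn_add2l.
  - lia.
  - by apply/mapP => -[i _]; lia.
  - by rewrite fill_out //; lia.
  - by move=> i ki; rewrite fill_out ?sk //; lia.
have clearE (z : 'I_m -> nat) y :
    fill k (fun=> 0) (enum 'I_m) (upd (fill k z (enum 'I_m) s) out y) = upd s out y.
  apply: funext => j; case: (boolP (k <= j < k + m)) => kj.
    have jm : j - k < m by lia.
    have -> : j = k + Ordinal jm by rewrite /=; lia.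
    rewrite fill_in mem_enum inE updE sk ?leq_addr //; case: eqP => //=; lia.
  by rewrite fill_out // !updE fill_out.
rewrite /= -/(run _); split.
  case=> _ /argsE [z gz ->] [_ /callE [y fy ->] /run_clear_seqs ->]; last exact: enum_uniq.
  exists y; last exact: clearE.
  by exists [tuple z i | i < m] => // i; rewrite tnth_mktuple; apply: gz; rewrite mem_enum.
case=> y [zs gz fy] ->.
have zsE : [tuple tnth zs i | i < m] = zs by apply: eq_from_tnth => i; rewrite tnth_mktuple.
exists (fill k (tnth zs) (enum 'I_m) s); first by apply/argsE; exists (tnth zs).
exists (upd (fill k (tnth zs) (enum 'I_m) s) out y).
  by apply/callE; exists y; rewrite ?zsE.
by apply/run_clear_seqs; rewrite ?enum_uniq ?clearE.
Qed.

Lemma compile_correct n (f : recfun n) : compiles f.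
Proof.
elim: f => {n} [n||n i|m n f IHf g IHg|n f IHf g IHg|n f IHf].
- exact: compile_zero.
- exact: compile_succ.
- exact: compile_proj.
- exact: compile_comp.
- exact: compile_prim.
- exact: compile_min.
Qed.

(** * Affine machines *)

Definition acceptor (f : recfun 1) := Seq (compile f [tuple 0] 1 2) (Do (Zero 1)).
Definition input n : store := upd (fun=> 0) 0 n.

Lemma acceptorP f n :
  (exists s, run (acceptor f) (input n) s) <-> rec_eval f [tuple n] 0.
Proof.
have callE t : run (compile f [tuple 0] 1 2) (input n) t <->
    exists2 y, rec_eval f [tuple n] y & t = upd (input n) 1 y.
  have -> : [tuple n] = [tuple of map (input n) [tuple 0]] by apply: val_inj.
  by apply: compile_correct; split=> //; case.
split=> [[s [t /callE [y fy ->] /= [y0 _]]]|f0].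
  by have {}y0 : y = 0 := y0; subst y.
exists (upd (input n) 1 0), (upd (input n) 1 0) => //.
by apply/callE; exists 0.
Qed.

(** A rule (p, a, p', a') rewrites p j + a into p' j + a', for every j.  It can
    multiply, divide exactly, and test residues. *)
Definition rule : Type := nat * nat * nat * nat.
Definition fires (r : rule) N N' :=
  let: (p, a, p', a') := r in exists j, N = p * j + a /\ N' = p' * j + a'.

Section Machine.
Variable St : countType.
Implicit Types (T : seq (St * rule * St)) (c : St * nat).

Definition mstep T c c' := exists2 r, (c.1, r, c'.1) \in T & fires r c.2 c'.2.

End Machine.

Fixpoint nth_prime i := if i is i'.+1 then s2val (prime_above (nth_prime i')) else 2.

Lemma nth_prime_prime i : prime (nth_prime i).
Proof. by case: i => //= i; case: prime_above. Qed.

Lemma nth_prime_inj : injective nth_prime.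
Proof.
have mono : {homo nth_prime : i j / i < j}.
  by apply: homo_ltn => [i j k|i] /=; [exact: ltn_trans|case: prime_above].
exact: (incn_inj (leq_mono mono)).
Qed.

(** Goedel numbering; other prime factors of N are allowed, since a rule for one
    register leaves the valuations at all other primes alone. *)
Definition encodes N (s : store) := 0 < N /\ forall i, logn (nth_prime i) N = s i.

Lemma logn_nth_prime i j : logn (nth_prime i) (nth_prime j) = (i == j).
Proof. by rewrite logn_prime ?nth_prime_prime // (inj_eq nth_prime_inj). Qed.

Lemma encodes_input n : encodes (2 ^ n) (input n).
Proof.
split=> [|i]; first by rewrite expn_gt0.
by rewrite -[2]/(nth_prime 0) lognX logn_nth_prime /input updE; case: eqP; lia.
Qed.

(** The zero test becomes the list of all nonzero residues modulo the prime of
    the register. *)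
Definition rules c : seq rule :=
  match c with
  | Nop => [:: (1, 0, 1, 0)]
  | Inc i => [:: (1, 0, nth_prime i, 0)]
  | Dec i => [:: (nth_prime i, 0, 1, 0)]
  | Zero i => [seq (nth_prime i, a, nth_prime i, a) | a <- iota 1 (nth_prime i).-1]
  end.

Lemma rules_sound c N N' s r : encodes N s -> r \in rules c -> fires r N N' ->
  exists2 s', exec c s s' & encodes N' s'.
Proof.
move=> [N0 Ns]; case: c => [|i|i|i] /=.
- rewrite inE => /eqP-> /= [j [Nj ->]]; exists s => //.
  have -> : 1 * j + 0 = N by lia.
  by [].
- rewrite inE => /eqP-> /= [j [Nj ->]]; exists (upd s i (s i).+1) => //.
  have -> : nth_prime i * j + 0 = nth_prime i * N by nia.
  have p0 := prime_gt0 (nth_prime_prime i).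
  split=> [|l]; first by rewrite muln_gt0 p0.
  rewrite lognM // Ns logn_nth_prime updE; case: eqP => [->|]; lia.
- rewrite inE => /eqP-> /= [j [Nj ->]]; exists (upd s i (s i).-1).
    split=> //; rewrite -Ns logn_gt0 mem_primes nth_prime_prime N0 Nj addn0.
    exact: dvdn_mulr.
  have {}Nj : N = nth_prime i * j by lia.
  have p0 := prime_gt0 (nth_prime_prime i).
  have j0 : 0 < j by case: (j) Nj N0 => // ->; rewrite muln0.
  rewrite mul1n addn0; split=> // l; have := Ns l.
  rewrite Nj lognM // logn_nth_prime updE -(Ns i) Nj lognM // logn_nth_prime eqxx.
  case: eqP => [->|_] /=; lia.
- case/mapP => a; rewrite mem_iota => a_in -> [j [Nj ->]]; rewrite -Nj.
  exists s => //; split=> //; rewrite -Ns; apply/eqP; rewrite eqn0Ngt logn_gt0 mem_primes.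
  rewrite nth_prime_prime N0 Nj /= dvdn_addr ?dvdn_mulr // gtnNdvd //; lia.
Qed.

Lemma rules_complete c N s s' : encodes N s -> exec c s s' ->
  exists r N', [/\ r \in rules c, fires r N N' & encodes N' s'].
Proof.
move=> [N0 Ns]; case: c => [|i|i|i] /=.
- move=> ->; exists (1, 0, 1, 0), N; split; rewrite ?inE //; exists N; lia.
- move=> ->; exists (1, 0, nth_prime i, 0), (nth_prime i * N); split; rewrite ?inE //.
    by exists N; lia.
  have p0 := prime_gt0 (nth_prime_prime i).
  split=> [|l]; first by rewrite muln_gt0 p0.
  rewrite lognM // Ns logn_nth_prime updE; case: eqP => [->|]; lia.
- case=> si ->; have p0 := prime_gt0 (nth_prime_prime i).
  have /dvdnP [j Nj] : nth_prime i %| N.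
    by move: si; rewrite -Ns logn_gt0 mem_primes => /and3P[].
  exists (nth_prime i, 0, 1, 0), j; split; rewrite ?inE //; first by exists j; lia.
  have j0 : 0 < j by case: (j) Nj N0 => // ->.
  split=> // l; have := Ns l.
  rewrite Nj lognM // logn_nth_prime updE -(Ns i) Nj lognM // logn_nth_prime eqxx.
  case: eqP => [->|_] /=; lia.
- case=> si ->; pose a := N %% nth_prime i.
  exists (nth_prime i, a, nth_prime i, a), N; split=> //; last first.
    by exists (N %/ nth_prime i); rewrite {1 3}(divn_eq N (nth_prime i)) mulnC.
  apply/mapP; exists a => //; rewrite mem_iota.
  have := ltn_pmod N (prime_gt0 (nth_prime_prime i)).
  have : 0 < a.
    rewrite lt0n; apply/negP => pN.
    have : 0 < logn (nth_prime i) N by rewrite logn_gt0 mem_primes nth_prime_prime N0.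
    by rewrite Ns si.
  lia.
Qed.

Definition instr_code c : GenTree.tree nat :=
  match c with
  | Nop => GenTree.Node 0 [::]
  | Inc i => GenTree.Node 0 [:: GenTree.Leaf i]
  | Dec i => GenTree.Node 1 [:: GenTree.Leaf i]
  | Zero i => GenTree.Node 2 [:: GenTree.Leaf i]
  end.

Fixpoint prog_code e : GenTree.tree nat :=
  match e with
  | Do c => instr_code c
  | Seq e1 e2 => GenTree.Node 3 [:: prog_code e1; prog_code e2]
  | Star e => GenTree.Node 4 [:: prog_code e]
  end.

Fixpoint prog_decode t : option prog :=
  match t with
  | GenTree.Node 0 [::] => Some (Do Nop)
  | GenTree.Node 0 [:: GenTree.Leaf i] => Some (Do (Inc i))
  | GenTree.Node 1 [:: GenTree.Leaf i] => Some (Do (Dec i))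
  | GenTree.Node 2 [:: GenTree.Leaf i] => Some (Do (Zero i))
  | GenTree.Node 3 [:: t1; t2] =>
      if (prog_decode t1, prog_decode t2) is (Some e1, Some e2)
      then Some (Seq e1 e2) else None
  | GenTree.Node 4 [:: t1] => omap Star (prog_decode t1)
  | _ => None
  end.

Lemma prog_codeK : pcancel prog_code prog_decode.
Proof. by elim=> [[]|e1 IH1 e2 IH2|e IH] //=; rewrite ?IH1 ?IH2 ?IH. Qed.

HB.instance Definition _ := Countable.copy prog (pcan_type prog_codeK).

(** The states of the machine are continuations, the lists of programs that
    remain to be run; [transitions e k] lists the finitely many moves from the
    continuation e :: k until k is reached. *)
Fixpoint transitions (e : prog) (k : seq prog) : seq (seq prog * rule * seq prog) :=
  let idle := (1, 0, 1, 0) : rule in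
  match e with
  | Do c => [seq (e :: k, r, k) | r <- rules c]
  | Seq e1 e2 => (e :: k, idle, [:: e1, e2 & k]) :: transitions e1 (e2 :: k) ++ transitions e2 k
  | Star e1 => [:: (e :: k, idle, k), (e :: k, idle, [:: e1, e & k]) & transitions e1 (e :: k)]
  end.

Lemma fires_idle N N' : fires (1, 0, 1, 0) N N' <-> N' = N.
Proof. by split=> [[j]|->]; [lia|exists N; lia]. Qed.

(** Soundness in the form of a backward invariant: a run of what remains after the
    move extends to a run of what remained before it. *)
Lemma transitions_sound e k st st' r N N' s : (st, r, st') \in transitions e k ->
  fires r N N' -> encodes N s -> exists2 s', encodes N' s' &
    forall s'', run (seqs st') s' s'' -> run (seqs st) s s''.
Proof.
elim: e k => [c|e1 IH1 e2 IH2|e IH] k /=.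
- case/mapP => r1 r1c [-> -> ->] fr Ns.
  have [s' cs Ns'] := rules_sound Ns r1c fr.
  by exists s' => // s'' run_k; exists s'.
- rewrite inE mem_cat => /or3P[/eqP[-> -> ->] /fires_idle -> Ns|/IH1|/IH2] //.
  exists s => // s'' [t run1 [u run2 run_k]]; exists u => //; exists t => //.
- rewrite !inE => /or3P[/eqP[-> -> ->] /fires_idle -> Ns
                       |/eqP[-> -> ->] /fires_idle -> Ns|/IH] //.
    by exists s => // s'' run_k; exists s => //; apply: ReachRefl.
  exists s => // s'' [t run1 [u run2 run_k]]; exists u => //; exact: ReachStep run1 run2.
Qed.

Lemma transitions_complete e k (T : seq (seq prog * rule * seq prog)) s s' N :
  {subset transitions e k <= T} -> run e s s' -> encodes N s ->
  exists2 N', encodes N' s' & reach (mstep T) (e :: k, N) (k, N').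
Proof.
elim: e k s s' N => [c|e1 IH1 e2 IH2|e IH] k s s' N sT.
- move=> cs Ns; have [r [N' [rc fr Ns']]] := rules_complete Ns cs.
  exists N' => //; apply: ReachStep (ReachRefl _); exists r => //.
  by apply: sT; apply/mapP; exists r.
- case=> t run1 run2 Ns.
  have [x|N1 Nt r1] := IH1 (e2 :: k) _ _ _ _ run1 Ns.
    by move=> xT; apply: sT; rewrite inE mem_cat xT orbT.
  have [x|N2 Ns' r2] := IH2 k _ _ _ _ run2 Nt.
    by move=> xT; apply: sT; rewrite inE mem_cat xT !orbT.
  exists N2 => //; apply: ReachStep (reach_trans r1 r2).
  by exists (1, 0, 1, 0); [apply: sT; rewrite inE eqxx|exact/fires_idle].
- rewrite /= => runs; elim: runs N => {s s'} [s|s t s' run1 _ IHs] N Ns.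
    exists N => //; apply: ReachStep (ReachRefl _).
    by exists (1, 0, 1, 0); [apply: sT; rewrite inE eqxx|exact/fires_idle].
  have [x|N1 Nt r1] := IH (Star e :: k) _ _ _ _ run1 Ns.
    by move=> xT; apply: sT; rewrite !inE xT !orbT.
  have [N2 Ns' r2] := IHs _ Nt.
  exists N2 => //; apply: ReachStep (reach_trans r1 r2).
  by exists (1, 0, 1, 0); [apply: sT; rewrite !inE eqxx orbT|exact/fires_idle].
Qed.

(** The start value is 2 ^ n because the input is in the register numbered 0,
    whose prime is 2. *)
Theorem machine_of_recfun (f : recfun 1) :
  exists (T : seq (seq prog * rule * seq prog)) (st : seq prog),
    forall n, (exists N, reach (mstep T) (st, 2 ^ n) ([::], N)) <->
      rec_eval f [tuple n] 0.
Proof.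
pose T := transitions (acceptor f) [::].
have sound c d : reach (mstep T) c d -> d.1 = [::] ->
    forall s, encodes c.2 s -> exists s', run (seqs c.1) s s'.
  elim=> {c d} [c -> s _|c c1 d [r cT fr] _ IH dN s Ns]; first by exists s.
  have [s1 Ns1 H] := transitions_sound cT fr Ns.
  by have [s' run1] := IH dN s1 Ns1; exists s'; apply: H.
exists T, [:: acceptor f] => n; rewrite -acceptorP; split.
  by case=> N /sound /(_ erefl _ (encodes_input n)) [s [t run_t _]]; exists t.
case=> s' run_s.
have [//|N' _ r] := @transitions_complete _ [::] T _ _ _ _ run_s (encodes_input n).
by exists N'.
Qed.

(** * Computing codes of words *)

Definition computes (f : recfun 1) (F : nat -> nat) :=
  forall n y, rec_eval f [tuple n] y <-> y = F n.
Definition computable F := exists f, computes f F.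

Lemma tuple1E (T : Type) (t : 1.-tuple T) : t = [tuple tnth t ord0].
Proof. by apply: eq_from_tnth => i; rewrite ord1. Qed.

Lemma rec_eval_comp n (f : recfun 1) (g : recfun n) xs y :
  rec_eval (RComp f (fun _ : 'I_1 => g)) xs y <->
  exists2 z, rec_eval g xs z & rec_eval f [tuple z] y.
Proof.
split=> /= [[zs gz fy]|[z gz fy]]; last by exists [tuple z] => // i; rewrite ord1.
by exists (tnth zs ord0); [exact: gz|rewrite -tuple1E].
Qed.

Lemma computable_comp F G : computable F -> computable G -> computable (F \o G).
Proof.
move=> [f fF] [g gG]; exists (RComp f (fun _ : 'I_1 => g)) => n y.
rewrite rec_eval_comp; split=> [[z /gG -> /fF]|->] //.
by exists (G n); [exact/gG|exact/fF].
Qed.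

Lemma computable_succ : computable succn. Proof. by exists RSucc. Qed.
Lemma computable_id : computable id. Proof. by exists (RProj ord0). Qed.
Lemma computable_const c : computable (fun=> c).
Proof.
elim: c => [|c IH]; first by exists (RZero 1).
exact: computable_comp computable_succ IH.
Qed.

(** Iteration is the form in which primitive recursion enters: codes of words grow
    by iterating the coding of one more letter. *)
Lemma computable_iter F B C : computable F -> computable B -> computable C ->
  computable (fun n => iter (C n) F (B n)).
Proof.
move=> [f fF] [b bB] [c cC].
pose g := RPrim b (RComp f (fun _ : 'I_1 => RProj (@Ordinal 3 1 isT))).
have gE k n y : rec_eval g [tuple k; n] y <-> y = iter k F (B n).
  change (rec_eval g [tuple k; n] y) with
    (prim_rec (rec_eval b) (rec_eval (RComp f (fun _ : 'I_1 => RProj (@Ordinal 3 1 isT))))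
      [tuple of behead [tuple k; n]] k y).
  have -> : [tuple of behead [tuple k; n]] = [tuple n] by apply: val_inj.
  have step i z w : rec_eval (RComp f (fun _ : 'I_1 => RProj (@Ordinal 3 1 isT)))
      [tuple i; z; n] w <-> w = F z.
    by rewrite rec_eval_comp; split=> [[_ -> /fF]|->] //; exists z => //; exact/fF.
  elim: k y => [|k IH] y; first exact: bB.
  split=> [[z /IH -> H]|->]; first exact/(step k).
  by exists (iter k F (B n)); [exact/IH|exact/(step k)].
exists (RComp g (fun i : 'I_2 => if i == ord0 then c else RProj ord0)) => n y.
split=> [[zs czs gy]|->].
  have zsE : zs = [tuple tnth zs ord0; tnth zs ord_max].
    apply: eq_from_tnth => -[[|[|]] // i2]; congr (tnth _ _); exact: val_inj.
  have /cC z0 := czs ord0; have /= z1 := czs ord_max.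
  by move: gy; rewrite zsE => /gE ->; rewrite z0 z1.
exists [tuple C n; n]; last exact/gE.
by case=> [[|[|]] // i2]; apply/cC.
Qed.

Lemma computable_double : computable double.
Proof.
have [f fE] := computable_iter (computable_comp computable_succ computable_succ)
  (computable_const 0) computable_id.
exists f => n y; rewrite fE; suff -> : iter n (succn \o succn) 0 = n.*2 by [].
by elim: n => //= n ->.
Qed.

Lemma ext_computable F G : computable F -> F =1 G -> computable G.
Proof. by move=> cF /funext <-. Qed.

Lemma computable_exp2M C B : computable C -> computable B ->
  computable (fun n => 2 ^ C n * B n).
Proof.
move=> cC cB; apply: ext_computable (computable_iter computable_double cB cC) _ => n.
by elim: (C n) => [|k /= ->]; rewrite ?mul1n // expnS -mul2n mulnA.
Qed.

Lemma computable_cons C B : computable C -> computable B ->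
  computable (fun n => 2 ^ C n * (B n).*2.+1).
Proof.
move=> cC cB; apply: computable_exp2M => //.
exact: computable_comp computable_succ (computable_comp computable_double cB).
Qed.

(** [CodeSeq.code] consumes a sequence from the right, so the code of s ++ t is
    obtained from that of t by this function. *)
Definition push (s : seq nat) m := foldr (fun l m => 2 ^ l * m.*2.+1) m s.

Lemma computable_push s : computable (push s).
Proof.
elim: s => [|l s IH]; first exact: computable_id.
exact: computable_cons (computable_const l) IH.
Qed.

Lemma push_nseq s k m : push (flatten (nseq k s)) m = iter k (push s) m.
Proof. by elim: k => //= k <-; rewrite /push foldr_cat. Qed.

Lemma rec_eval_functional n (f : recfun n) xs y y' :
  rec_eval f xs y -> rec_eval f xs y' -> y = y'.
Proof.
elim: f xs y y' => {n} [n||n i|m n f IHf g IHg|n f IHf g IHg|n f IHf] xs y y' /=.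
- by move=> -> ->.
- by move=> -> ->.
- by move=> -> ->.
- case=> zs gz fy [zs' gz' fy']; apply: IHf fy _.
  suff -> : zs = zs' by [].
  by apply: eq_from_tnth => i; apply: IHg (gz i) (gz' i).
- elim: (thead xs) y y' => [|k IH] y y' /=; first exact: IHf.
  by case=> z fz gy [z' /(IH _ _ fz) <-]; apply: IHg.
- case=> fy H [fy' H']; case: (ltngtP y y') => // yy.
    by have [v /(IHf _ _ _ fy)] := H' _ yy.
  by have [v /(IHf _ _ _ fy')] := H _ yy.
Qed.

(** * Permutation groups and paths of commuting elements *)

Local Open Scope group_scope.

Section Symmetric.
Variable T : Type.

(** Permutations of an arbitrary type.  Products are composed from left to right,
    so a product of generators is read as a sequence of successive moves. *)
Record sym := Sym {
  sym_fun :> T -> T;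
  sym_inv : T -> T;
  sym_funK : cancel sym_fun sym_inv;
  sym_invK : cancel sym_inv sym_fun }.

Lemma symP (f g : sym) : f =1 g -> f = g.
Proof.
case: f g => [f f' fK f'K] [g g' gK g'K] /= /funext eq_fg; subst g.
have eq_inv : f' = g' by apply: funext => x; rewrite -{1}[x]g'K fK.
by subst g'; congr Sym; exact: Prop_irrelevance.
Qed.

Definition sym1 : sym := @Sym id id (fun=> erefl) (fun=> erefl).
Definition symM (f g : sym) : sym :=
  Sym (can_comp (sym_funK g) (sym_funK f)) (can_comp (sym_invK f) (sym_invK g)).
Definition symV (f : sym) : sym := Sym (sym_invK f) (sym_funK f).

HB.instance Definition _ := gen_eqMixin sym.
HB.instance Definition _ := gen_choiceMixin sym.

Fact symA : associative symM. Proof. by move=> f g h; exact: symP. Qed.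
Fact sym1M : left_id sym1 symM. Proof. by move=> f; exact: symP. Qed.
Fact symM1 : right_id sym1 symM. Proof. by move=> f; exact: symP. Qed.
Fact symVM : left_inverse sym1 symV symM.
Proof. by move=> f; apply: symP => x /=; rewrite sym_invK. Qed.
Fact symMV : right_inverse sym1 symV symM.
Proof. by move=> f; apply: symP => x /=; rewrite sym_funK. Qed.

HB.instance Definition _ := isGroup.Build sym symA sym1M symM1 symVM symMV.

Lemma symME (f g : sym) x : (f * g) x = g (f x). Proof. by []. Qed.
Lemma symVE (f : sym) x : f^-1 x = sym_inv f x. Proof. by []. Qed.

Lemma symXE (f : sym) n x : (f ^+ n) x = iter n f x.
Proof. by elim: n x => [|n IH] x //; rewrite expgSr iterS symME IH. Qed.

Lemma sym_commute (f g : sym) : (forall x, f (g x) = g (f x)) -> commute f g.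
Proof. by move=> fg; apply: symP => x /=; rewrite fg. Qed.

Lemma commute_symE (f g : sym) x : commute f g -> f (g x) = g (f x).
Proof. by move=> fg; rewrite -!symME fg. Qed.

End Symmetric.

Section Path.
Variables (G : groupType) (a b : G).
Hypothesis ab : commute (a ^+ 2) (b ^+ 2).

(** [walk i] is the alternating word a b a ... of length i, and [turn i] the
    letter that prolongs it. *)
Definition turn i := if odd i then b else a.
Fixpoint walk i := if i is i'.+1 then walk i' * turn i' else 1.
Definition vertex i := turn i ^+ 2 ^ (walk i)^-1.

Lemma commute_conj (x y z : G) : commute x y -> commute (x ^ z) (y ^ z).
Proof. by rewrite /commute -!conjMg => ->. Qed.

(** [vertex i] is unchanged if the conjugating walk is prolonged by the letter
    [turn i], which commutes with its own square; then both vertices are conjugates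
    of a^2 and b^2 by the same element. *)
Lemma vertex_commute i : commute (vertex i) (vertex i.+1).
Proof.
have -> : vertex i = turn i ^+ 2 ^ (walk i.+1)^-1.
  rewrite /vertex /= invgM conjgM; congr (_ ^ _).
  by rewrite conjgE invgK expg2 !mulgA mulgK.
apply: commute_conj; rewrite /turn /=; case: (odd i) => //=.
Qed.
End Path.

(** The point (w, e) of the set T * nat lies over the edge joining the vertices
    e - 1 and e of a half-line.  The generator of parity [par] exchanges the two
    edges at each vertex of that parity, and the permutation attached to the
    vertex acts on the way back; so its square acts over both edges as that
    permutation.  An edge joins vertices of different parity, whose permutations
    commute: hence the two squares commute. *)
Section PathAction.
Variables (T : Type) (v : nat -> sym T).
Hypothesis v_commute : forall i, commute (v i) (v i.+1).

Definition cross_fun (par : bool) (x : T * nat) : T * nat :=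
  let: (w, e) := x in
  if odd e == par then (w, e.+1) else if e is e'.+1 then (v e' w, e') else x.

Definition cross_inv (par : bool) (x : T * nat) : T * nat :=
  let: (w, e) := x in
  if odd e == par then ((v e)^-1 w, e.+1) else if e is e'.+1 then (w, e') else x.

Fact cross_funK par : cancel (cross_fun par) (cross_inv par).
Proof.
case=> w e /=; case: (boolP (odd e == par)) => /= [/eqP <-|]; first by case: (odd e).
case: e => [|e] /=; first by case: par.
by case: (boolP (odd e == par)) => [|+ /negP]; [rewrite sym_funK|case: (odd e) par => -[]].
Qed.

Fact cross_invK par : cancel (cross_inv par) (cross_fun par).
Proof.
case=> w e /=; case: (boolP (odd e == par)) => /= [/eqP <-|].
  by case: (odd e) => /=; rewrite sym_invK.
case: e => [|e] /=; first by case: par.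
by case: (boolP (odd e == par)) => [|+ /negP] //; case: (odd e) par => -[].
Qed.

Definition cross par : sym (T * nat) := Sym (cross_funK par) (cross_invK par).

Lemma crossE par w e : odd e = par -> cross par (w, e) = (w, e.+1).
Proof. by move=> /= ->; rewrite eqxx. Qed.

Lemma cross2_up par w e : odd e = par -> (cross par ^+ 2) (w, e) = (v e w, e).
Proof.
by move=> oe; rewrite expg2 symME crossE //= oe; case: par {oe}; rewrite /= ?eqxx.
Qed.

Lemma cross2_down par w e :
  odd e = par -> (cross par ^+ 2) (w, e.+1) = (v e w, e.+1).
Proof.
by case: par => oe; rewrite expg2 symME /= oe /= oe.
Qed.

Lemma cross2_end w : (cross true ^+ 2) (w, 0) = (w, 0).
Proof. by []. Qed.

Lemma cross_commute : commute (cross false ^+ 2) (cross true ^+ 2).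
Proof.
apply: sym_commute => -[w [|e]].
  by rewrite cross2_end cross2_up // cross2_end.
case oe: (odd e).
  have oe1 : odd e.+1 = false by rewrite /= oe.
  by rewrite !(cross2_up _ oe1, cross2_down _ oe) (commute_symE _ (v_commute e)).
have oe1 : odd e.+1 = true by rewrite /= oe.
by rewrite !(cross2_up _ oe1, cross2_down _ oe) (commute_symE _ (v_commute e)).
Qed.

Lemma walkE i w : walk (cross false) (cross true) i (w, 0) = (w, i).
Proof.
elim: i => // i IH; rewrite [walk _ _ _]/= symME IH /turn.
by case oi : (odd i); rewrite crossE.
Qed.

Lemma vertexE i w : vertex (cross false) (cross true) i (w, 0) = (v i w, 0).
Proof.
rewrite /vertex conjgE invgK symME walkE symME.
have -> : (turn (cross false) (cross true) i ^+ 2) (w, i) = (v i w, i).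
  by rewrite /turn; by case oi : (odd i); rewrite cross2_up.
by rewrite symVE -[X in sym_inv _ X]walkE sym_funK.
Qed.
End PathAction.

(** * The group presented by two generators with commuting squares *)

Import GRing.Theory.
Local Open Scope classical_set_scope.

(** The integers as a multiplicative group; the alias keeps this structure apart
    from the ring structure of int. *)
Definition mint : Type := int.
HB.instance Definition _ := Choice.on mint.

Section IntegersAsGroup.
Let one : mint := 0%R.
Let mul (x y : mint) : mint := (x + y)%R.
Let inv (x : mint) : mint := (- x)%R.
Fact mintA : associative mul. Proof. exact: addrA. Qed.
Fact mint1M : left_id one mul. Proof. exact: add0r. Qed.
Fact mintM1 : right_id one mul. Proof. exact: addr0. Qed.
Fact mintVM : left_inverse one inv mul. Proof. exact: addNr. Qed.
Fact mintMV : right_inverse one inv mul. Proof. exact: addrN. Qed.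
HB.instance Definition _ := isGroup.Build mint mintA mint1M mintM1 mintVM mintMV.
End IntegersAsGroup.

Lemma mintM (x y : mint) : x * y = (x + y : int)%R. Proof. by []. Qed.
Lemma mintV (x : mint) : x^-1 = (- x : int)%R. Proof. by []. Qed.

Section IntPowers.
Variable G : groupType.

Definition zpow (x : G) (n : int) : G :=
  match n with Posz m => x ^+ m | Negz m => x ^- m.+1 end.

Lemma zpowS x (n : int) : zpow x (n + 1)%R = zpow x n * x.
Proof.
case: n => [m|[|m]].
- have -> : (Posz m + 1)%R = Posz m.+1 by lia.
  exact: expgSr.
- by rewrite /= mulVg.
- have -> : (Negz m.+1 + 1)%R = Negz m by lia.
  by rewrite /= (expgS x m.+1) invgM mulgVK.
Qed.

Lemma zpowD x (m n : int) : zpow x (m + n)%R = zpow x m * zpow x n.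
Proof.
have pos (k : nat) (i : int) : zpow x (i + k%:Z)%R = zpow x i * x ^+ k.
  elim: k i => [|k IH] i; first by rewrite addr0 mulg1.
  have -> : (i + k.+1%:Z)%R = (i + k%:Z + 1)%R by lia.
  by rewrite zpowS IH -mulgA -expgSr.
case: n => [k|k]; first exact: pos.
have := pos k.+1 (m + Negz k)%R.
have -> : (m + Negz k + k.+1%:Z)%R = m by lia.
by move=> ->; rewrite mulgK.
Qed.

Lemma zpow_double x (k : int) : zpow x (k + k)%R = zpow (x ^+ 2) k.
Proof.
rewrite zpowD; case: k => k /=; first by rewrite -expgMn // -expg2.
by rewrite -invgM -expgMn // -expg2.
Qed.

Lemma zpow_commute (x y : G) (m n : int) : commute x y -> commute (zpow x m) (zpow y n).
Proof.
move=> xy; have {}xy i j : commute (x ^+ i) (y ^+ j) by apply: commuteX2.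
case: m n => i [j|j] //=.
- exact: commuteV.
- exact/commute_sym/commuteV/commute_sym.
- exact/commuteV/commute_sym/commuteV/commute_sym.
Qed.

End IntPowers.

Local Notation mint1 := (1%Z : mint).

Lemma subgroup_ops (G : groupType) (N : set G) : is_subgroup N ->
  [/\ N 1, forall x y, N x -> N y -> N (x * y), forall x, N x -> N x^-1
    & forall x n, N x -> N (zpow x n)].
Proof.
move=> Ng; have [/set_mem N1 _] := Ng.
have NM x y : N x -> N y -> N (x * y).
  by move=> /mem_set Nx /mem_set Ny; apply/set_mem/(group_closedM Ng).
have NV x : N x -> N x^-1 by move=> /mem_set Nx; apply/set_mem/(group_closedV Ng).
have NX x n : N x -> N (x ^+ n).
  by move=> Nx; elim: n => // n IH; rewrite expgS; apply: NM.
by split=> // x [n|n] Nx /=; [|apply: NV]; apply: NX.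
Qed.

(** Hence a morphism from [mint] is determined by its value at 1. *)
Lemma mintE (n : mint) : n = zpow mint1 n.
Proof.
have natE (k : nat) : mint1 ^+ k = (Posz k : mint).
  by elim: k => // k IH; rewrite expgSr IH mintM; lia.
by case: n => k; rewrite /= ?natE // mintV; lia.
Qed.

Lemma mint_cyclic : infinite_cyclic mint.
Proof.
split.
  move/(@finite_image mint nat _ absz); suff -> : absz @` [set: mint] = [set: nat].
    exact: infinite_nat.
  by apply/seteqP; split=> // n _; exists (Posz n : mint).
exists mint1; apply/seteqP; split=> // n _ N [/subgroup_ops[_ _ _ NX] N1].
by rewrite (mintE n); apply: NX; apply: N1.
Qed.

Definition even_mint : set mint := [set x | exists k : mint, x = k * k].

Lemma even_mint_subgroup : is_subgroup even_mint.
Proof.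
split; first by apply/mem_set; exists 1; rewrite mulg1.
move=> x y /set_mem[k ->] /set_mem[l ->]; apply/mem_set.
by exists (k / l); rewrite !(mintM, mintV); lia.
Qed.

(** Evaluation of words of the free product of two copies of the integers, the
    generators being sent to x and y. *)
Definition lift_letter (G : groupType) (x y : G) (l : mint + mint) : G :=
  match l with inl n => zpow x n | inr n => zpow y n end.

Definition lift_word (G : groupType) (x y : G) (u : seq (mint + mint)) : G :=
  \prod_(l <- u) lift_letter x y l.

Lemma lift_wordP (G : groupType) (x y : G) u u' :
  fprod_eq u u' -> lift_word x y u = lift_word x y u'.
Proof.
rewrite /lift_word; elim=> {u u'} //.
- by move=> u v w _ -> _ ->.
- by move=> u u' v v' _ eu _ ev; rewrite !big_cat /= eu ev.
- by rewrite big_seq1 big_nil.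
- by rewrite big_seq1 big_nil.
- by move=> m n; rewrite big_cons !big_seq1 /= mintM zpowD.
- by move=> m n; rewrite big_cons !big_seq1 /= mintM zpowD.
Qed.

Definition torus_group := fprod_commuting even_mint even_mint.
Definition torus_l : torus_group := quot_ncl_pi _ (fprod_inl mint mint1).
Definition torus_r : torus_group := quot_ncl_pi _ (fprod_inr mint mint1).

Lemma quot_ncl_mulE (G : groupType) (X : set G) (x y : quot_ncl X) :
  x * y = quot_ncl_mul x y.
Proof. by []. Qed.

(** The universal property of the presentation < a, b | [a^2, b^2] >. *)
Definition square_commuting_universal (G : groupType) (a b : G) :=
  forall (S : groupType) (x y : S), commute (x ^+ 2) (y ^+ 2) ->
    exists phi : G -> S, [/\ {morph phi : g h / g * h}, phi a = x & phi b = y].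

Lemma torus_universal : square_commuting_universal torus_l torus_r.
Proof.
move=> G x y xy; pose psi (p : free_product mint mint) := lift_word x y (repr p).
have psiE u : psi (fprod_pi u) = lift_word x y u.
  by apply: lift_wordP; apply/fprod_piP; rewrite fprod_piK.
have psiM : {morph psi : p q / p * q}.
  move=> p q; rewrite -(fprod_piK p) -(fprod_piK q).
  change (fprod_pi (repr p) * fprod_pi (repr q)) with
    (fprod_mul (fprod_pi (repr p)) (fprod_pi (repr q))).
  by rewrite -fprod_piM !psiE /lift_word big_cat.
have psi1 : psi 1 = 1 by apply: (mulgI (psi 1)); rewrite -psiM !mulg1.
have psiV p : psi p^-1 = (psi p)^-1.
  by apply/esym/mulg1_eq; rewrite -psiM mulgV.
have ker p : normal_closure (cross_commutators even_mint even_mint) p -> psi p = 1.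
  move=> /(_ [set q | psi q = 1]); apply; split; last first.
    move=> _ [h [k [[m ->] [n ->] ->]]]; rewrite /= !psiM !psiV !psiE /lift_word !big_seq1 /=.
    rewrite !zpow_double (zpow_commute _ _ xy) mulgK mulgV //.
  split; last by move=> g h /= pg; rewrite conjgE !psiM psiV pg mul1g mulVg.
  split; first exact/mem_set.
  by move=> g h /set_mem pg /set_mem ph; apply/mem_set; rewrite /= psiM psiV pg ph mulgV.
pose phi (q : torus_group) := psi (repr q).
have phiE p : phi (quot_ncl_pi _ p) = psi p.
  have /quot_ncl_piP/ker : quot_ncl_pi (cross_commutators even_mint even_mint) p =
     quot_ncl_pi _ (repr (quot_ncl_pi (cross_commutators even_mint even_mint) p)).
    by rewrite quot_ncl_piK.
  by rewrite psiM psiV => /mulg1_eq; rewrite invgK.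
exists phi; split.
- move=> g h; rewrite -(quot_ncl_piK g) -(quot_ncl_piK h) quot_ncl_mulE -quot_ncl_piM.
  by rewrite !phiE psiM.
- by rewrite phiE psiE /lift_word big_seq1.
- by rewrite phiE psiE /lift_word big_seq1.
Qed.

Lemma morph_ops (G1 G2 : groupType) (f : G1 -> G2) : {morph f : x y / x * y} ->
  [/\ f 1 = 1, {morph f : x / x^-1}, forall n, {morph f : x / x ^+ n}
    & forall n, {morph f : x / zpow x n}].
Proof.
move=> fM; have f1 : f 1 = 1 by apply: (mulgI (f 1)); rewrite -fM !mulg1.
have fV : {morph f : x / x^-1}.
  by move=> x; apply/esym/mulg1_eq; rewrite -fM mulgV.
have fX n : {morph f : x / x ^+ n}.
  by move=> x; elim: n => // n IH; rewrite !expgS fM IH.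
by split=> // -[n|n] x /=; rewrite ?fV fX.
Qed.

Local Notation torus_pi := (quot_ncl_pi (cross_commutators even_mint even_mint)).

Lemma torus_piM : {morph torus_pi : p q / p * q}.
Proof. exact: quot_ncl_piM. Qed.

Lemma torus_inlM : {morph torus_pi \o @fprod_inl mint mint : m n / m * n}.
Proof.
move=> m n /=; rewrite -torus_piM; congr (torus_pi _).
by rewrite -[RHS]fprod_piM; apply/fprod_piP/FprodSym; exact: FprodMulL.
Qed.

Lemma torus_inrM : {morph torus_pi \o @fprod_inr mint mint : m n / m * n}.
Proof.
move=> m n /=; rewrite -torus_piM; congr (torus_pi _).
by rewrite -[RHS]fprod_piM; apply/fprod_piP/FprodSym; exact: FprodMulR.
Qed.

Lemma torus_commute : commute (torus_l ^+ 2) (torus_r ^+ 2).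
Proof.
pose h := fprod_inl mint (mint1 * mint1); pose k := fprod_inr mint (mint1 * mint1).
have -> : torus_l ^+ 2 = torus_pi h by exact/esym/torus_inlM.
have -> : torus_r ^+ 2 = torus_pi k by exact/esym/torus_inrM.
have [pi1 piV _ _] := morph_ops torus_piM.
have : torus_pi (h * k * h^-1 * k^-1) = 1.
  rewrite -pi1; apply/esym/quot_ncl_piP; rewrite invg1 mul1g => N [_]; apply.
  by exists (mint1 * mint1), (mint1 * mint1); split=> //; exists mint1.
rewrite !torus_piM !piV => /divg1_eq hk; rewrite /commute.
by rewrite -{2}hk mulgVK.
Qed.

Lemma torus_generates : generates [tuple torus_l; torus_r].
Proof.
apply/seteqP; split=> // g _ N [/subgroup_ops[N1 NM _ NX] NS].
have Nl : N torus_l by apply: NS; rewrite /= inE eqxx.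
have Nr : N torus_r by apply: NS; rewrite /= !inE eqxx orbT.
have [pi1 _ _ _] := morph_ops torus_piM.
rewrite -(quot_ncl_piK g) -(fprod_piK (repr g)); elim: (repr (repr g)) => [|l u IH].
  by change (N (torus_pi 1)); rewrite pi1.
have -> : fprod_pi (l :: u) = fprod_pi [:: l] * fprod_pi u by rewrite -[RHS]fprod_piM.
rewrite torus_piM; apply: NM IH; case: l => n; rewrite (mintE n).
  have [_ _ _ /(_ n mint1) E] := morph_ops torus_inlM.
  by rewrite -[torus_pi _]/((torus_pi \o @fprod_inl mint mint) _) E; apply: NX.
have [_ _ _ /(_ n mint1) E] := morph_ops torus_inrM.
by rewrite -[torus_pi _]/((torus_pi \o @fprod_inr mint mint) _) E; apply: NX.
Qed.

(** * Substituting permutations for the vertices *)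

(** Words in letters v_i, the letter (i, true) standing for the inverse of v_i;
    the same word is evaluated in the group G and in permutation groups. *)
Definition vword := seq (nat * bool).

Definition wval (G : groupType) (v : nat -> G) (w : vword) : G :=
  \prod_(l <- w) (if l.2 then (v l.1)^-1 else v l.1).

Lemma wval_cat (G : groupType) (v : nat -> G) w1 w2 :
  wval v (w1 ++ w2) = wval v w1 * wval v w2.
Proof. exact: big_cat. Qed.

Lemma wval_cons (G : groupType) (v : nat -> G) l w :
  wval v (l :: w) = (if l.2 then (v l.1)^-1 else v l.1) * wval v w.
Proof. exact: big_cons. Qed.

Lemma wval1 (G : groupType) (v : nat -> G) l :
  wval v [:: l] = if l.2 then (v l.1)^-1 else v l.1.
Proof. exact: big_seq1. Qed.

Lemma wval_nil (G : groupType) (v : nat -> G) : wval v [::] = 1.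
Proof. exact: big_nil. Qed.

Lemma wval_nseq (G : groupType) (v : nat -> G) n i (s : bool) :
  wval v (nseq n (i, s)) = (if s then (v i)^-1 else v i) ^+ n.
Proof. by elim: n => [|n IH]; rewrite ?wval_nil //= wval_cons IH -expgS. Qed.

(** Membership is refuted by an invariant: if permutations v of T, consecutive
    ones commuting, are substituted for the vertices, a set that is preserved by
    the generators of a submonoid is preserved by all its elements.  The reason is
    that G acts on T * nat so that [vertex a b i] acts on T * 0 as v i. *)
Lemma submonoid_invariant (G : groupType) (a b : G) (T : Type) (v : nat -> sym T)
    (U : vword) (W : seq vword) (I : set T) :
  square_commuting_universal a b ->
  (forall i, commute (v i) (v i.+1)) ->
  (forall w, w \in W -> forall t, I t -> I (wval v w t)) ->
  submonoid_gen [set wval (vertex a b) w | w in [set` W]] (wval (vertex a b) U) ->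
  forall t, I t -> I (wval v U t).
Proof.
move=> univ vC IW.
have [phi [phiM phia phib]] := univ _ _ _ (cross_commute vC).
have [phi1 phiV _ _] := morph_ops phiM.
have turnE j : phi (turn a b j) = turn (cross v false) (cross v true) j.
  by rewrite /turn; case: ifP.
have walkE j : phi (walk a b j) = walk (cross v false) (cross v true) j.
  by elim: j => //= j IH; rewrite phiM IH turnE.
have phi_vertex i t : phi (vertex a b i) (t, 0) = (v i t, 0).
  by rewrite -(vertexE v) /vertex !conjgE !phiM !phiV !turnE walkE.
have phi_word w t : phi (wval (vertex a b) w) (t, 0) = (wval v w t, 0).
  elim: w t => [|[i s] w IH] t; first by rewrite !wval_nil phi1.
  rewrite !wval_cons phiM !symME /=; case: s => /=; last by rewrite phi_vertex IH.
  rewrite -IH phiV; congr (phi _ _).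
  by rewrite !symVE -[t in LHS](sym_invK (v i)) -phi_vertex sym_funK.
move=> UW.
pose M : set G := [set g | forall t, I t -> exists2 t', phi g (t, 0) = (t', 0) & I t'].
have : M (wval (vertex a b) U).
  apply: UW; split.
    split; first by apply/mem_set => t It; exists t; rewrite ?phi1.
    move=> g h /set_mem Mg /set_mem Mh; apply/mem_set => t /Mg [t1 gt /Mh [t2 ht It]].
    by exists t2 => //; rewrite phiM symME gt.
  move=> _ [w /= wW <-] t It; exists (wval v w t); [exact: phi_word|exact: IW].
by move=> MU t /MU [t']; rewrite phi_word => -[->].
Qed.

(** The lines of the star are indexed by nat and meet in [Hub]; [Pos c k] and
    [Neg c k] are at distance k + 1 from it, on either side of the line c. *)
Inductive star := Hub | Pos of nat & nat | Neg of nat & nat.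

Definition star_out c (s : star) : star :=
  match s with
  | Hub => Pos c 0
  | Pos d k => if d == c then Pos d k.+1 else s
  | Neg d k => if d == c then (if k is k'.+1 then Neg d k' else Hub) else s
  end.

Definition star_in c (s : star) : star :=
  match s with
  | Hub => Neg c 0
  | Pos d k => if d == c then (if k is k'.+1 then Pos d k' else Hub) else s
  | Neg d k => if d == c then Neg d k.+1 else s
  end.

Fact star_outK c : cancel (star_out c) (star_in c).
Proof.
by case=> [|d k|d [|k]] /=; rewrite ?eqxx //; case: eqP => //= [->|];
  rewrite ?eqxx //; case: eqP.
Qed.

Fact star_inK c : cancel (star_in c) (star_out c).
Proof.
by case=> [|d [|k]|d k] /=; rewrite ?eqxx //; case: eqP => //= [->|];
  rewrite ?eqxx //; case: eqP.
Qed.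

Section Control.
Variables (Q : Type) (u : nat -> sym Q).
Hypothesis u_commute : forall i, i < 3 -> commute (u i) (u i.+1).

Definition at_hub (f : Q -> Q) (x : Q * star) : Q * star :=
  if x.2 is Hub then (f x.1, Hub) else x.

Fact at_hubK (f g : Q -> Q) : cancel f g -> cancel (at_hub f) (at_hub g).
Proof. by move=> fK [w []] //=; rewrite /at_hub /= fK. Qed.

Definition hub_sym (f : sym Q) : sym (Q * star) :=
  Sym (at_hubK (sym_funK f)) (at_hubK (sym_invK f)).

Definition line_sym c : sym (Q * star) :=
  Sym (T := Q * star) (sym_fun := fun x => (x.1, star_out c x.2))
      (sym_inv := fun x => (x.1, star_in c x.2))
    (fun x => etrans (congr1 (pair x.1) (star_outK c x.2)) (esym (surjective_pairing x)))
    (fun x => etrans (congr1 (pair x.1) (star_inK c x.2)) (esym (surjective_pairing x))).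

(** Even indices from 4 on act trivially, so that letters of odd index are not
    adjacent to anything that moves. *)
Definition control (i : nat) : sym (Q * star) :=
  match i with
  | 0 | 1 | 2 | 3 => hub_sym (u i)
  | i'.+4 => if odd i' then line_sym i'./2 else 1
  end.

Lemma hub_commute f g : commute f g -> commute (hub_sym f) (hub_sym g).
Proof.
move=> fg; apply: sym_commute => -[w []] //=.
by rewrite /at_hub /= (commute_symE _ fg).
Qed.

Lemma control_commute i : commute (control i) (control i.+1).
Proof.
case: i => [|[|[|[|i]]]]; try by apply/hub_commute/u_commute.
  exact: commute1.
rewrite /=; case: (odd i) => /=; first exact: commute1.
exact/commute_sym/commute1.
Qed.

(** Odd and larger than 4, so that no two control letters are adjacent and none is
    adjacent to alpha, x, y, delta. *)
Definition key c := (c.*2.+1).+4.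
Definition edge_word (c : nat) (l : vword) (c' : nat) : vword :=
  (key c, true) :: l ++ [:: (key c', false)].

Lemma control_key c : control (key c) = line_sym c.
Proof. by rewrite /= odd_double /= uphalf_double. Qed.

Lemma control_word l : all (fun x => x.1 < 4) l -> forall w,
  wval control l (w, Hub) = (wval u l w, Hub) /\
  forall s, s <> Hub -> wval control l (w, s) = (w, s).
Proof.
elim: l => [|[i b] l IH] /=; first by move=> _ w; rewrite !wval_nil.
case/andP=> i4 /IH{}IH w.
have lE : (if b then (control i)^-1 else control i) = hub_sym (if b then (u i)^-1 else u i).
  by case: i i4 => [|[|[|[|]]]] // _; case: b => //; apply: symP.
rewrite !wval_cons lE !symME /=.
have [hubE offE] := IH (hub_sym (if b then (u i)^-1 else u i) (w, Hub)).1.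
split; first exact: hubE.
by move=> s sB; case: s sB => // ? ? _; have [_ H] := IH w; exact: H.
Qed.

(** A generator s_c^-1 l s_c' acts on (w, Pos d k) as follows.  If d = c and
    k = 0, the point enters the hub, w is changed by l, and the point leaves along
    the line c'.  Otherwise it never meets the hub, w is unchanged, and the point
    stays on the positive part of the line d: misplaced generators are harmless.
    So the points of the positive half-lines, with w constrained by the line,
    form an invariant set. *)
Lemma edge_invariant (inv : nat -> Q -> Prop) c l c' :
  all (fun x => x.1 < 4) l ->
  (forall w, inv c w -> inv c' (wval u l w)) ->
  let I := [set x : Q * star | if x.2 is Pos d _ then inv d x.1 else False] in
  forall x, I x -> I (wval control (edge_word c l c') x).
Proof.
move=> l4 invl I [w [|d k|]] // /= Id.
rewrite /edge_word wval_cons wval_cat wval1 !symME !control_key symVE.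
have [hubE offE] := control_word l4 w.
rewrite /=; case: eqP => [dc|dc]; last by rewrite offE //= /I /=; case: eqP.
subst d; move: k Id => [|k] Id; last by rewrite offE //= /I /=; case: eqP.
by rewrite hubE /I /=; apply: invl.
Qed.

End Control.

(** * Encoding affine machines in submonoids *)

(** In a triple (i, j, h), i and j are the exponents of x and y, and h counts the
    occasions on which alpha met a nonzero j or delta a nonzero i. *)
Definition gauge : Type := int * int * int.

Definition shift_x (e : int) (w : gauge) : gauge := let: (i, j, h) := w in (i + e, j, h)%R.
Definition shift_y (e : int) (w : gauge) : gauge := let: (i, j, h) := w in (i, j + e, h)%R.
Definition count_y (e : int) (w : gauge) : gauge :=
  let: (i, j, h) := w in (i, j, h + e * Posz (j != 0))%R.
Definition count_x (e : int) (w : gauge) : gauge :=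
  let: (i, j, h) := w in (i, j, h + e * Posz (i != 0))%R.

Fact shift_xK e : cancel (shift_x e) (shift_x (- e)).
Proof. by case=> [[i j] h] /=; rewrite addrK. Qed.
Fact shift_yK e : cancel (shift_y e) (shift_y (- e)).
Proof. by case=> [[i j] h] /=; rewrite addrK. Qed.
Fact count_xK e : cancel (count_x e) (count_x (- e)).
Proof. by case=> [[i j] h] /=; rewrite mulNr addrK. Qed.
Fact count_yK e : cancel (count_y e) (count_y (- e)).
Proof. by case=> [[i j] h] /=; rewrite mulNr addrK. Qed.

(** The permutations standing for alpha, x, y, delta, in this order. *)
Definition gauge_sym (i : nat) : sym gauge :=
  match i with
  | 0 => Sym (count_yK 1) (count_yK (- 1))
  | 1 => Sym (shift_xK 1) (shift_xK (- 1))
  | 2 => Sym (shift_yK 1) (shift_yK (- 1))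
  | _ => Sym (count_xK 1) (count_xK (- 1))
  end.

Lemma gauge_commute i : i < 3 -> commute (gauge_sym i) (gauge_sym i.+1).
Proof.
by case: i => [|[|[|]]] // _; apply: symP => -[[i j] h].
Qed.

Lemma gauge_shift p p' i j h :
  wval gauge_sym (nseq p (1%N, true) ++ nseq p' (2, false)) (i, j, h) =
  (i - Posz p, j + Posz p', h)%R.
Proof.
rewrite wval_cat !wval_nseq symME !symXE /=.
have -> : iter p (gauge_sym 1)^-1 (i, j, h) = (i - Posz p, j, h)%R.
  elim: p => [|p IH] /=; first by rewrite subr0.
  by rewrite IH /= -addrA; congr (_, _, _); congr (_ + _)%R; lia.
elim: p' => [|p' IH] /=; first by rewrite addr0.
by rewrite IH /= -addrA; congr (_, _, _); congr (_ + _)%R; lia.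
Qed.

(** The exponent of x is exhausted exactly when delta has to be passed, so that
    the parts in y cancel around delta. *)
Lemma transfer_product (G : groupType) (al x y de : G) p a p' a' n :
  commute al x -> commute x y -> commute y de ->
  al * (x^-1 ^+ a * y ^+ a') * (x^-1 ^+ p * y ^+ p') ^+ n * de *
    (y^-1 * x) ^+ (p' * n + a') = x ^- (p * n + a) * (al * de) * x ^+ (p' * n + a').
Proof.
move=> alx xy yde; have Xy i j : commute (x^-1 ^+ i) (y ^+ j).
  by apply/commuteX2/commute_sym/commuteV/commute_sym.
rewrite expgMn // -!expgnA; set N' := (p' * n + a')%N.
have -> : al * (x^-1 ^+ a * y ^+ a') * (x^-1 ^+ (p * n) * y ^+ (p' * n)) =
    al * x^-1 ^+ (p * n + a) * y ^+ N'.
  rewrite /N' addnC (addnC (p' * n)%N) !expgnDr !mulgA; congr (_ * _).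
  by rewrite -!mulgA; congr (_ * (_ * _)); apply/esym/Xy.
rewrite expgMn; last exact/commute_sym/commuteV.
have -> : al * x^-1 ^+ (p * n + a) = x^-1 ^+ (p * n + a) * al by apply/commuteX/commuteV.
have -> : y^-1 ^+ N' = y ^- N' by rewrite expVgn.
rewrite -(expVgn x) -!mulgA; congr (_ * (_ * _)); rewrite !mulgA.
have -> : y ^+ N' * de = de * y ^+ N' by apply/commute_sym/commuteX/commute_sym.
by rewrite mulgK.
Qed.

Section Encoding.
Variable St : countType.

(** [Main q] is the machine in state q with N as exponent of x; [Transfer t] turns
    powers of x into powers of y according to the rule of the transition t, and
    [Copy q] turns powers of y back into powers of x. *)
Inductive ctl := Start | Drop | Erase | Main of St | Copy of St
               | Transfer of St * rule * St.

Definition ctl_code (c : ctl) : 'I_3 + (St + St + St * rule * St) :=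
  match c with
  | Start => inl ord0
  | Drop => inl (@Ordinal 3 1 isT)
  | Erase => inl ord_max
  | Main q => inr (inl (inl q))
  | Copy q => inr (inl (inr q))
  | Transfer t => inr (inr t)
  end.

Definition ctl_decode (x : 'I_3 + (St + St + St * rule * St)) : ctl :=
  match x with
  | inl i => if nat_of_ord i is i'.+1 then (if i' is 0 then Drop else Erase) else Start
  | inr (inl (inl q)) => Main q
  | inr (inl (inr q)) => Copy q
  | inr (inr t) => Transfer t
  end.

Lemma ctl_codeK : cancel ctl_code ctl_decode. Proof. by case. Qed.
HB.instance Definition _ := Countable.copy ctl (can_type ctl_codeK).

Variables (T : seq (St * rule * St)) (q0 qf : St).

(** The letters 0, 1, 2, 3 are alpha, x, y, delta.  An edge (c, l, c') gives the
    generator s_c^-1 l s_c'. *)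
Definition transition_edges (t : St * rule * St) : seq (ctl * vword * ctl) :=
  let: (q, (p, a, p', a'), q') := t in
  [:: (Main q, (0, false) :: nseq a (1%N, true) ++ nseq a' (2, false), Transfer t);
      (Transfer t, nseq p (1%N, true) ++ nseq p' (2, false), Transfer t);
      (Transfer t, [:: (3, false)], Copy q');
      (Copy q', [:: (2, true); (1%N, false)], Copy q');
      (Copy q', [::], Main q')].

Definition edges : seq (ctl * vword * ctl) :=
  [:: (Start, [::], Main q0), (Main qf, [::], Drop), (Drop, [:: (1%N, true)], Drop),
      (Drop, [::], Erase), (Erase, [:: (3, true); (0, true)], Erase)
    & flatten [seq transition_edges t | t <- T]].

Definition path_word (c : ctl) l (c' : ctl) := edge_word (pickle c) l (pickle c').
Definition edge_words := [seq path_word e.1.1 e.1.2 e.2 | e <- edges].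
Definition target N := path_word Start (nseq N (1%N, true)) Erase.

Section Soundness.
Variable N0 : nat.

Let R q N := reach (mstep T) (q0, N0) (q, N).
Let accept := exists N, R qf N.

(** What is known of (i, j, h) in each control state.  Everything is conditional
    on h = 0: on the way to [Erase], h never decreases, hence an error made once
    cannot be hidden.  In [Erase] the counter may decrease, but only away from
    i = j = 0, and there i and j do not change any more. *)
Definition ctl_inv (c : ctl) (w : gauge) : Prop :=
  let: (i, j, h) := w in
  match c with
  | Start => w = (Posz N0, Posz 0, Posz 0)
  | Main q | Copy q => (0 <= h)%R /\ (h = 0%R -> exists2 N, R q N & (i + j = Posz N)%R)
  | Transfer (q, (p, a, p', a'), q') => (0 <= h)%R /\ (h = 0%R ->
      (q, (p, a, p', a'), q') \in T /\ exists N n : nat,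
        [/\ R q N, Posz N = (i + Posz (p * n + a))%R & j = Posz (p' * n + a')])
  | Drop => (0 <= h)%R /\ (h = 0%R -> accept)
  | Erase => i = 0%R -> j = 0%R -> (0 <= h)%R /\ (h = 0%R -> accept)
  end.

Lemma edge_inv e : e \in edges -> forall w,
  ctl_inv e.1.1 w -> ctl_inv e.2 (wval gauge_sym e.1.2 w).
Proof.
have nilE w : wval gauge_sym [::] w = w by rewrite wval_nil.
rewrite !inE => /or4P[/eqP->|/eqP->|/eqP->|/or3P[/eqP->|/eqP->|]] /=.
- case=> [[i j] h] -[-> -> ->]; rewrite nilE; split=> // _; exists N0; last by lia.
  exact: ReachRefl.
- case=> [[i j] h]; rewrite nilE /= => -[h0 H]; split=> // /H [N RN _]; by exists N.
- by case=> [[i j] h] /=; rewrite wval1.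
- by case=> [[i j] h] D; rewrite nilE => _ _.
- case=> [[i j] h]; rewrite wval_cons wval1 /= => H i0 j0.
  have [h0 acc] := H i0 j0; subst i j; rewrite /= in H *.
  have -> : (h + -1 * Posz (0 != 0 :> int) + -1 * Posz (0 != 0 :> int))%R = h.
    by rewrite eqxx; lia.
  by [].
case/flatten_mapP => -[[q [[[p a] p'] a']] q'] tT.
rewrite !inE => /or4P[/eqP->|/eqP->|/eqP->|/orP[/eqP->|/eqP->]] /=.
- case=> [[i j] h] [h0 H]; rewrite wval_cons symME /= gauge_shift /=.
  split; first lia.
  move=> h1; have [j0 h2] : j = 0%R /\ h = 0%R by lia.
  have [N RN E] := H h2.
  by split=> //; exists N, 0; split=> //; lia.
- case=> [[i j] h] [h0 H]; rewrite gauge_shift /=; split=> // /H [_ [N [n [RN E1 E2]]]].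
  by split=> //; exists N, n.+1; split=> //; lia.
- case=> [[i j] h] [h0 H]; rewrite wval1 /=; split; first lia.
  move=> h1; have [i0 h2] : i = 0%R /\ h = 0%R by lia.
  have [_ [N [n [RN E1 E2]]]] := H h2.
  exists (p' * n + a'); last lia.
  apply: reach_trans RN (ReachStep _ (ReachRefl _)).
  by exists (p, a, p', a') => //; exists n; split=> //; move: E1; rewrite i0 add0r => -[->].
- case=> [[i j] h] [h0 H]; rewrite wval_cons wval1 /=; split=> // /H [N RN E].
  by exists N => //; lia.
- by case=> [[i j] h]; rewrite nilE.
Qed.

Lemma edge_letters e : e \in edges -> all (fun x => x.1 < 4) e.1.2.
Proof.
rewrite !inE => /or4P[/eqP->|/eqP->|/eqP->|/or3P[/eqP->|/eqP->|]] //.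
case/flatten_mapP => -[[q [[[p a] p'] a']] q'] tT.
rewrite !inE => /or4P[/eqP->|/eqP->|/eqP->|/orP[/eqP->|/eqP->]] //=.
  by rewrite all_cat !all_nseq !orbT.
by rewrite all_cat !all_nseq !orbT.
Qed.

(** The target word moves the point (N0, 0, 0) on the line of [Start] to (0, 0, 0)
    on the line of [Erase], where the invariant asserts that the machine halts. *)
Lemma membership_sound (G : groupType) (a b : G) :
  square_commuting_universal a b ->
  submonoid_gen [set wval (vertex a b) w | w in [set` edge_words]]
    (wval (vertex a b) (target N0)) -> accept.
Proof.
move=> univ mem.
pose inv n w := if @unpickle ctl n is Some c then ctl_inv c w else False.
pose I := [set x : gauge * star | if x.2 is Pos d _ then inv d x.1 else False].
have II : forall w, w \in edge_words -> forall x, I x -> I (wval (control gauge_sym) w x).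
  move=> _ /mapP[e ee ->]; apply: edge_invariant; first exact: edge_letters.
  by move=> w; rewrite /inv !pickleK; apply: edge_inv.
have Istart : I (Posz N0, Posz 0, Posz 0, Pos (pickle Start) 0) by rewrite /I /= /inv pickleK.
have := submonoid_invariant univ (control_commute gauge_commute) II mem Istart.
rewrite /target /path_word /edge_word wval_cons wval_cat wval1 !symME !control_key symVE.
have -> : sym_inv (line_sym gauge (pickle Start))
      (Posz N0, Posz 0, Posz 0, Pos (pickle Start) 0) = (Posz N0, Posz 0, Posz 0, Hub).
  exact: (congr1 (pair (Posz N0, Posz 0, Posz 0)) (star_outK (pickle Start) Hub)).
have l4 : all (fun x => x.1 < 4) (nseq N0 (1%N, true)) by rewrite all_nseq orbT.
have [-> _] := control_word gauge_sym l4 (Posz N0, Posz 0, Posz 0).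
have := gauge_shift N0 0 (Posz N0) 0 0; rewrite cats0 => ->.
rewrite /I /= /inv pickleK /= => H.
have [||_] := H; [lia|lia|exact].
Qed.

End Soundness.

Section Completeness.
Variables (G : groupType) (V : nat -> G).
Hypothesis V_commute : forall i, i < 3 -> commute (V i) (V i.+1).

Let M : set G := submonoid_gen [set wval V w | w in [set` edge_words]].
Let path (c : ctl) g (c' : ctl) := M ((V (key (pickle c)))^-1 * g * V (key (pickle c'))).

Lemma submonoid_gen_closed X (x y : G) :
  submonoid_gen X x -> submonoid_gen X y -> submonoid_gen X (x * y).
Proof.
move=> Mx My N NX; have [[_ NM] _] := NX.
by apply/set_mem/NM; apply/mem_set; [exact: Mx|exact: My].
Qed.

Let path1 c : path c 1 c.
Proof. by rewrite /path mulg1 mulVg => N NX; have [[N1 _] _] := NX; exact: set_mem N1. Qed.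

Let pathM c c1 c2 g h : path c g c1 -> path c1 h c2 -> path c (g * h) c2.
Proof. by move=> pg ph; have := submonoid_gen_closed pg ph; rewrite /path !mulgA mulgK. Qed.

Let pathX c g n : path c g c -> path c (g ^+ n) c.
Proof. by move=> pg; elim: n => [|n IH]; rewrite ?path1 // expgS; apply: pathM IH. Qed.

Let path_edge c l c' : (c, l, c') \in edges -> path c (wval V l) c'.
Proof.
move=> e; apply: sub_gen_smallest; exists (path_word c l c'); last first.
  by rewrite /path_word /edge_word wval_cons wval_cat wval1 mulgA.
by rewrite /=; apply/mapP; exists (c, l, c').
Qed.

(** One step of the machine appends one factor alpha delta to the record. *)
Let path_step q q' N N' : mstep T (q, N) (q', N') ->
  path (Main q) (V 1 ^- N * (V 0 * V 3) * V 1 ^+ N') (Main q').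
Proof.
case=> -[[[p a] p'] a'] /= tT [n [-> ->]].
have e i : i \in transition_edges (q, (p, a, p', a'), q') -> i \in edges.
  move=> it; rewrite !inE; do 5! (apply/orP; right).
  by apply/flatten_mapP; exists (q, (p, a, p', a'), q').
pose t : ctl := Transfer (q, (p, a, p', a'), q').
have := path_edge (e _ (mem_head _ _)).
have := path_edge (e (t, nseq p (1%N, true) ++ nseq p' (2, false), t) _).
rewrite !inE eqxx orbT => /(_ isT) /(pathX n) p2 /pathM/(_ p2).
have := path_edge (e (t, [:: (3, false)], Copy q') _).
rewrite !inE eqxx !orbT => /(_ isT) p3 /pathM/(_ p3).
have := path_edge (e (Copy q', [:: (2, true); (1%N, false)], Copy q') _).
rewrite !inE eqxx !orbT => /(_ isT) /(pathX (p' * n + a')) p4 /pathM/(_ p4).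
have := path_edge (e (Copy q', [::], Main q') _).
rewrite !inE eqxx !orbT => /(_ isT) p5 /pathM/(_ p5).
rewrite wval_cons !wval_cat !wval_nseq wval1 wval_cons wval1 wval_nil mulg1.
by rewrite transfer_product //; apply: V_commute.
Qed.

Let path_reach q q' N N' : reach (mstep T) (q, N) (q', N') ->
  exists t, path (Main q) (V 1 ^- N * (V 0 * V 3) ^+ t * V 1 ^+ N') (Main q').
Proof.
move ec: (q, N) => c; move ed: (q', N') => d r.
elim: r q N ec ed => {c d} [c|c c1 d cc1 _ IH] q N ec ed.
  by move: ed; rewrite -ec => -[-> ->]; exists 0; rewrite mulg1 mulVg; apply: path1.
case: c1 cc1 IH => q1 N1; rewrite -ec => cc1 /(_ _ _ erefl ed) [t pt].
exists t.+1; have := pathM (path_step cc1) pt.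
by rewrite !mulgA mulgK expgS !mulgA.
Qed.

Lemma membership_complete N0 : (exists N, reach (mstep T) (q0, N0) (qf, N)) ->
  submonoid_gen [set wval V w | w in [set` edge_words]] (wval V (target N0)).
Proof.
case=> N /path_reach [t pt].
have := pathM (path_edge (_ : (Start, [::], Main q0) \in edges)) pt.
rewrite !inE eqxx => /(_ isT) /pathM/(_ (path_edge (_ : (Main qf, [::], Drop) \in edges))).
rewrite !inE eqxx orbT => /(_ isT).
have := path_edge (_ : (Drop, [:: (1%N, true)], Drop) \in edges).
rewrite !inE eqxx !orbT => /(_ isT) /(pathX N) p2 /pathM/(_ p2).
have := path_edge (_ : (Drop, [::], Erase) \in edges).
rewrite !inE eqxx !orbT => /(_ isT) p3 /pathM/(_ p3).
have := path_edge (_ : (Erase, [:: (3, true); (0, true)], Erase) \in edges).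
rewrite !inE eqxx !orbT => /(_ isT) /(pathX t) p4 /pathM/(_ p4).
rewrite !(wval_cons, wval_nil) !(mulg1, mul1g) /=.
rewrite -invgM !expVgn !mulgK.
by rewrite /path wval_cat wval_nseq wval1 expVgn /= !mulgA.
Qed.

End Completeness.
End Encoding.

(** * The diagonal argument *)

Section Words.
Variables (G : groupType) (k : nat) (S : k.-tuple G).

Lemma sword_val_cat (w1 w2 : sword k) :
  sword_val S (w1 ++ w2) = sword_val S w1 * sword_val S w2.
Proof. exact: big_cat. Qed.

Lemma sword_val_surj : generates S -> forall g, exists w, sword_val S w = g.
Proof.
move=> Sgen g.
have : [set: G] g by [].
rewrite -Sgen => /(_ [set g | exists w, sword_val S w = g]); apply; split; last first.
  move=> x /= /tnthP [i ->]; exists [:: (i, false)]; exact: big_seq1.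
split; first by apply/mem_set; exists [::]; exact: big_nil.
move=> x y /set_mem[w <-] /set_mem[w' <-]; apply/mem_set.
exists (w ++ rev [seq (l.1, ~~ l.2) | l <- w']); rewrite sword_val_cat; congr (_ * _).
elim: w' => [|[i b] w' IH]; first by rewrite /sword_val !big_nil invg1.
rewrite /= rev_cons -cats1 sword_val_cat IH -[(i, b) :: w']cat1s sword_val_cat invgM.
congr (_ * _).
by rewrite /sword_val !big_seq1; case: b => /=; rewrite ?invgK.
Qed.

End Words.

(** The prefix wS, the repeated word wX and the suffix wE are fixed before the
    machine is built: only their number of repetitions depends on the input, so
    that the codes of the target words are computable. *)
Lemma undecidable_membership (G : groupType) (a b : G) :
  square_commuting_universal a b ->
  commute (a ^+ 2) (b ^+ 2) -> generates [tuple a; b] ->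
  submonoid_membership_undecidable G.
Proof.
move=> univ ab gen; split; first by exists 2, [tuple a; b].
move=> k S Sgen [f fP].
have [spell spellE] := choice (sword_val_surj Sgen).
pose V := vertex a b; pose St := (seq prog : countType).
have VC i : i < 3 -> commute (V i) (V i.+1) by move=> _; exact: vertex_commute.
pose wS := spell (V (key (pickle (Start St))))^-1.
pose wX := spell (V 1%N)^-1.
pose wE := spell (V (key (pickle (Erase St)))).
pose letters (w : sword k) := [seq (l.1.*2 + l.2)%N | l : 'I_k * bool <- w].
pose U n := wS ++ flatten (nseq (2 ^ n)%N wX) ++ wE.
have UE n : sword_val S (U n) = wval V (target St (2 ^ n)).
  rewrite /U !sword_val_cat !spellE /target /path_word /edge_word wval_cons wval_cat wval1.
  congr (_ * (_ * _)); rewrite wval_nseq; elim: (2 ^ n)%N => [|m IH] /=.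
    exact: big_nil.
  by rewrite sword_val_cat IH spellE expgS.
have codeU n : sword_code (U n) =
    push (letters wS) (iter (2 ^ n)%N (push (letters wX)) (sword_code wE)).
  rewrite /sword_code -/(letters (U n)) -/(letters wE) /U /letters !map_cat.
  rewrite map_flatten map_nseq.
  by rewrite -push_nseq /push -!foldr_cat -catA.
pose inst n := (2 ^ sword_code (U n) * n.*2.+1)%N.
have [g gE] : computable inst.
  apply: computable_cons; last exact: computable_id.
  apply: (ext_computable _ (fun n => esym (codeU n))).
  apply: computable_comp (computable_push _) _.
  apply: computable_iter (computable_push _) (computable_const _) _.
  apply: ext_computable (computable_exp2M computable_id (computable_const 1)) _ => n.
  by rewrite muln1.
have [T [st machineP]] := machine_of_recfun (RComp f (fun _ : 'I_1 => g)).
pose W := [seq spell (wval V w) | w <- edge_words T st [::]].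
(* The number on which the machine is run against its own list of generators. *)
pose d := CodeSeq.code [seq sword_code w | w <- W].
have [bit fd bitP] := fP (U d, W).
have instE : instance_code (U d, W) = inst d by [].
have membershipE : submonoid_membership S (U d, W) <-> rec_eval f [tuple inst d] 0.
  rewrite /submonoid_membership /= UE.
  have -> : [set sword_val S w | w in [set` W]] =
            [set wval V w | w in [set` edge_words T st [::]]].
    apply/seteqP; split=> [_ [w /mapP[e eE ->] <-]|_ [e eE <-]].
      by exists e => //; rewrite spellE.
    by exists (spell (wval V e)); [exact: map_f|rewrite spellE].
  have -> : rec_eval f [tuple inst d] 0 <->
      exists N, reach (mstep T) (st, (2 ^ d)%N) ([::], N).
    rewrite machineP rec_eval_comp; split=> [f0|[z /gE -> //]].
    by exists (inst d) => //; apply/gE.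
  by split=> [/(membership_sound univ)|/(membership_complete VC)].
rewrite instE in fd; case: bit fd bitP => fd [bP Pb].
  by have /membershipE := bP isT; move/(rec_eval_functional fd).
by have := Pb (membershipE.2 fd).
Qed.

Theorem corollary3p11 :
  exists (A B : groupType) (H : set A) (K : set B),
    [/\ infinite_cyclic A, infinite_cyclic B, is_subgroup H, is_subgroup K
      & submonoid_membership_undecidable (fprod_commuting H K)].
Proof.
exists mint, mint, even_mint, even_mint.
split; try exact: mint_cyclic; try exact: even_mint_subgroup.
exact: undecidable_membership torus_universal torus_commute torus_generates.
Qed.
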